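(* Let $X_1,X_2,\ldots$ be independent and uniformly distributed random vectors on a bounded convex domain $\Omega\subset\mathbb{R}^d$ and let $0<\alpha<\infty$ and $0<\gamma\le\infty$. Consider the random $n$-point set $P_n=\{X_1,\dots,X_n\}$. Then, for $n\ge2$, $$\mathbb{E}\,\|\operatorname{dist}(\cdot,P_n)\|_{L_\gamma(\Omega)}^{\alpha}\asymp\begin{cases} n^{-\alpha/d} & \text{if } 0<\gamma<\infty,\\ n^{-\alpha/d}(\log n)^{\alpha/d} & \text{if }\gamma=\infty,\end{cases}$$ with implied constants independent of $n$.
   Context: A domain is a nonempty open subset of $\mathbb{R}^d$. $\operatorname{dist}(x,P)=\min_{y\in P}\|x-y\|_2$. For $0<\gamma<\infty$, $\|g\|_{L_\gamma(\Omega)}=(\int_\Omega|g|^\gamma dx)^{1/\gamma}$ (a quasi-norm if $\gamma<1$), and $\|g\|_{L_\infty(\Omega)}$ is the essential supremum. A random vector $X$ is uniformly distributed on $\Omega$ if $\mathbb{P}[X\in A]=\operatorname{vol}(A\cap\Omega)/\operatorname{vol}(\Omega)$ for all Lebesgue-measurable $A\subset\mathbb{R}^d$. $a\asymp b$ means that $c\,b\le a\le C\,b$ with constants $0<c\le C<\infty$, which may depend on $\Omega,d,\alpha,\gamma$ only. *)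

(* Defs.v *)
From HB Require Import structures.
From mathcomp Require Import all_boot all_order all_algebra.
From mathcomp Require Import all_classical all_reals all_analysis.
From mathcomp Require Import measurable_realfun.

Set Implicit Arguments.
Unset Strict Implicit.
Unset Printing Implicit Defensive.
Import Order.TTheory GRing.Theory Num.Theory.
Import numFieldNormedType.Exports.

Local Open Scope classical_set_scope.
Local Open Scope ring_scope.

(* R^d is 'rV[R]_d. Its sigma-algebra is the one generated by the coordinates,
   i.e. the d-fold power of the Borel sigma-algebra of R, which is the Borel
   sigma-algebra of R^d. *)
Definition rV_display : measure_display -> measure_display.
Proof. exact. Qed.

Section measurable_rV.
Context {R : realType} (d : nat).

Let coord (i : 'I_d) (x : 'rV[R]_d) : R := x ord0 i.

Let rV_set0 : g_sigma_preimage coord set0.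
Proof. exact: sigma_algebra0. Qed.

Let rV_setC A : g_sigma_preimage coord A -> g_sigma_preimage coord (~` A).
Proof. exact: sigma_algebraC. Qed.

Let rV_bigcup (F : _^nat) : (forall i, g_sigma_preimage coord (F i)) ->
  g_sigma_preimage coord (\bigcup_i (F i)).
Proof. exact: sigma_algebra_bigcup. Qed.

HB.instance Definition _ := @isMeasurable.Build
  (rV_display default_measure_display) 'rV[R]_d (g_sigma_preimage coord)
  rV_set0 rV_setC rV_bigcup.

End measurable_rV.

Lemma measurable_coord (R : realType) d (i : 'I_d) :
  measurable_fun [set: 'rV[R]_d] (fun x => x ord0 i).
Proof.
move=> _ Y mY; rewrite setTI; apply: sub_sigma_algebra => /=.
rewrite -bigcup_seq/=; exists i => /=; first by rewrite mem_index_enum.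
by exists Y => //; rewrite setTI.
Qed.

Lemma measurable_fun_coordP d1 (T : measurableType d1) (R : realType) d
    (f : T -> 'rV[R]_d) :
  measurable_fun [set: T] f <->
  forall i, measurable_fun [set: T] (fun t => f t ord0 i).
Proof.
split=> [mf i|mf].
  by apply: (measurableT_comp (f := fun x : 'rV[R]_d => x ord0 i) _ mf);
     exact: measurable_coord.
move=> _ A mA; rewrite setTI.
suff: g_sigma_preimage (fun (i : 'I_d) (x : 'rV[R]_d) => x ord0 i : R) `<=`
    [set B | measurable (f @^-1` B)] by move=> /(_ A mA).
apply: smallest_sub.
  split; first by rewrite /= preimage_set0.
    by move=> B mB; rewrite /= setTD preimage_setC; exact: measurableC.
  move=> F mF; rewrite /= preimage_bigcup.
  by apply: bigcupT_measurable => n; exact: mF.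
rewrite -bigcup_seq => B [i _ [C mC <-]] /=.
by rewrite setTI -[X in measurable X]setTI; exact: mf.
Qed.

Definition rV_cons (R : realType) d (p : R * 'rV[R]_d) : 'rV[R]_d.+1 :=
  row_mx (const_mx p.1 : 'rV[R]_1) p.2.

Lemma rV_cons0 (R : realType) d (p : R * 'rV[R]_d) : rV_cons p ord0 ord0 = p.1.
Proof.
have := row_mxEl (const_mx p.1 : 'rV[R]_1) p.2 ord0 ord0.
by rewrite [RHS]mxE => <-; congr (rV_cons p _ _); exact: val_inj.
Qed.

Lemma rV_consS (R : realType) d (p : R * 'rV[R]_d) (i : 'I_d) :
  rV_cons p ord0 (lift ord0 i) = p.2 ord0 i.
Proof.
have := row_mxEr (const_mx p.1 : 'rV[R]_1) p.2 ord0 i.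
by move=> <-; congr (rV_cons p _ _); exact: val_inj.
Qed.

Lemma measurable_rV_cons (R : realType) d : measurable_fun setT (@rV_cons R d).
Proof.
apply/measurable_fun_coordP => i; case: (unliftP ord0 i) => [j|] ->.
  under eq_fun do rewrite rV_consS.
  by apply: (measurableT_comp (f := fun x : 'rV[R]_d => x ord0 j));
    [exact: measurable_coord|exact: measurable_snd].
by under eq_fun do rewrite rV_cons0; exact: measurable_fst.
Qed.

(* One step of the construction of the Lebesgue measure: the product of the
   one-dimensional Lebesgue measure and m, transported to R^(d+1). *)
Section lebesgue_step.
Context {R : realType} {d : nat}.
Variable m : {sigma_finite_measure set 'rV[R]_d -> \bar R}.

Definition lebesgue_step : set 'rV[R]_d.+1 -> \bar R :=
  pushforward (@lebesgue_measure R \x m)%E (@rV_cons R d).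

Let step0 : lebesgue_step set0 = 0%E.
Proof. by rewrite /lebesgue_step /pushforward preimage_set0 measure0. Qed.

Let step_ge0 A : (0 <= lebesgue_step A)%E.
Proof. rewrite /lebesgue_step /pushforward; exact: measure_ge0. Qed.

Let measurable_preimage (A : set 'rV[R]_d.+1) : measurable A ->
  measurable (@rV_cons R d @^-1` A).
Proof.
by move=> mA; rewrite -[X in measurable X]setTI; exact: measurable_rV_cons.
Qed.

Let step_sigma_additive : semi_sigma_additive lebesgue_step.
Proof.
move=> F mF tF mUF; rewrite /lebesgue_step /pushforward preimage_bigcup.
apply: measure_semi_sigma_additive.
- by move=> n; exact: measurable_preimage.
- apply/trivIsetP => /= i j _ _ ij; rewrite -preimage_setI.
  by move/trivIsetP : tF => /(_ _ _ _ _ ij) ->//; rewrite preimage_set0.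
- by rewrite -preimage_bigcup; exact: measurable_preimage.
Qed.

HB.instance Definition _ := isMeasure.Build _ _ _ lebesgue_step
  step0 step_ge0 step_sigma_additive.

Let step_sigma_finite : sigma_finite setT lebesgue_step.
Proof.
have /sigma_finiteP[F [TF ndF Foo]] := sigma_finiteT (@lebesgue_measure R).
have /sigma_finiteP[G [TG ndG Goo]] := sigma_finiteT m.
pose tl (x : 'rV[R]_d.+1) : 'rV[R]_d := \row_i x ord0 (lift ord0 i).
have tlE p : tl (rV_cons p) = p.2.
  by apply/rowP => i; rewrite mxE rV_consS.
have mtl : measurable_fun setT tl.
  apply/measurable_fun_coordP => i; under eq_fun do rewrite mxE.
  exact: measurable_coord.
exists (fun n => [set x : 'rV[R]_d.+1 | F n (x ord0 ord0)] `&`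
                 [set x | G n (tl x)]).
  rewrite predeqE => x; split=> // _.
  have [k _ Fk] : (\bigcup_i F i) (x ord0 ord0) by rewrite -TF.
  have [l _ Gl] : (\bigcup_i G i) (tl x) by rewrite -TG.
  exists (maxn k l) => //; split => /=.
    by move: (x ord0 ord0) Fk; exact/subsetPset/ndF/leq_maxl.
  by move: (tl x) Gl; exact/subsetPset/ndG/leq_maxr.
move=> n; have [mFn Fnoo] := Foo n; have [mGn Gnoo] := Goo n; split.
  apply: measurableI; rewrite -[X in measurable X]setTI.
    by apply: measurable_coord.
  by apply: mtl.
rewrite /lebesgue_step /pushforward (_ : _ @^-1` _ = F n `*` G n).
  by rewrite product_measure1E// lte_mul_pinfty// ge0_fin_numE.
by apply/seteqP; split=> -[x y] /=; rewrite tlE rV_cons0.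
Qed.

HB.instance Definition _ := Measure_isSigmaFinite.Build _ _ _ lebesgue_step
  step_sigma_finite.

End lebesgue_step.

(* The Lebesgue measure on the Borel sets of R^d. *)
Fixpoint lebesgue_rV (R : realType) (d : nat) :
    {sigma_finite_measure set 'rV[R]_d -> \bar R} :=
  match d with
  | 0 => \d_(0 : 'rV[R]_0)
  | d'.+1 => lebesgue_step (lebesgue_rV R d')
  end.

(* This identity determines lebesgue_rV R d. *)
Lemma lebesgue_rV_box (R : realType) d (A : 'I_d -> set R) :
  (forall i, measurable (A i)) ->
  lebesgue_rV R d [set x : 'rV[R]_d | forall i, A i (x ord0 i)] =
  (\prod_(i < d) lebesgue_measure (A i))%E.
Proof.
elim: d A => [|d IH] A mA; first by rewrite big_ord0 /= diracE mem_set// => -[].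
pose B := [set x : 'rV[R]_d | forall i, A (lift ord0 i) (x ord0 i)].
have mB : measurable B.
  rewrite (_ : B = \bigcap_(i in [set: 'I_d])
      ((fun x : 'rV[R]_d => x ord0 i) @^-1` A (lift ord0 i))).
    apply: fin_bigcap_measurable => // i _; rewrite -[X in measurable X]setTI.
    exact: measurable_coord.
  by apply/seteqP; split=> x /= Ax i; [move=> _|]; exact: Ax.
rewrite big_ord_recl -(IH (fun i => A (lift ord0 i)))//.
rewrite -[RHS](product_measure1E (@lebesgue_measure R) (lebesgue_rV R d)
                 (mA _) mB).
rewrite /= /lebesgue_step /pushforward; congr product_measure1.
apply/seteqP; split=> -[x y] /= => [Axy|[Ax Ay] i].
  split=> [|i]; first by have := Axy ord0; rewrite rV_cons0.
  by have := Axy (lift ord0 i); rewrite rV_consS.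
case: (unliftP ord0 i) => [j|] ->; first by rewrite rV_consS; exact: Ay.
by rewrite rV_cons0.
Qed.

(* A is Lebesgue measurable if it is the union of a Borel set and of a subset
   of a Borel null set; vol extends the Lebesgue measure to such sets. *)
Definition lebesgue_measurable (R : realType) d (A : set 'rV[R]_d) : Prop :=
  completed_algebra_gen (lebesgue_rV R d) A.

Definition vol (R : realType) d (A : set 'rV[R]_d) : \bar R :=
  mu_ext (lebesgue_rV R d) A.

(* The norm carried by 'rV[R]_d in the library is the maximum norm. *)
Definition norm2 (R : realType) d (x : 'rV[R]_d) : R :=
  Num.sqrt (\sum_(i < d) x ord0 i ^+ 2).

(* The infimum is a minimum for finite nonempty P. *)
Definition dist (R : realType) d (x : 'rV[R]_d) (P : set 'rV[R]_d) : R :=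
  inf [set norm2 (x - y) | y in P].

(* The L_gamma(D) (quasi-)norm of g, for 0 < gamma <= +oo: g is extended by
   zero outside of D. *)
Definition Lnorm_on (R : realType) d (D : set 'rV[R]_d) (gamma : \bar R)
    (g : 'rV[R]_d -> R) : \bar R :=
  Lnorm (lebesgue_rV R d) gamma (fun x => (g x * \1_D x)%:E).

Section random_vectors.
Context {dT} {T : measurableType dT} {R : realType} (P : probability T R).
Context (d : nat).

(* P need not be complete, so that Y @^-1` A may fail to be an event when A is
   not a Borel set. *)
Definition uniformly_distributed (Y : {RV P >-> 'rV[R]_d})
    (D : set 'rV[R]_d) : Prop :=
  forall A, lebesgue_measurable A -> measurable (Y @^-1` A) ->
    P (Y @^-1` A) = (fine (vol (A `&` D)) / fine (vol D))%:E.

Definition independent (X : nat -> {RV P >-> 'rV[R]_d}) : Prop :=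
  forall (J : seq nat) (B : nat -> set 'rV[R]_d), uniq J ->
    (forall i, i \in J -> measurable (B i)) ->
    P (\bigcap_(i in [set` J]) (X i @^-1` B i)) =
      (\prod_(i <- J) P (X i @^-1` B i))%E.

(* The random vectors are numbered from 0. *)
Definition sample (X : nat -> {RV P >-> 'rV[R]_d}) (n : nat) (w : T) :
  set 'rV[R]_d := [set X i w | i in `I_n].

End random_vectors.

Definition rate (R : realType) (d : nat) (alpha : R) (gamma : \bar R)
    (n : nat) : R :=
  if gamma == +oo%E then
    n%:R `^ (- (alpha / d%:R)) * ln n%:R `^ (alpha / d%:R)
  else n%:R `^ (- (alpha / d%:R)).

(* Main.v *)
Require Import Defs.
From mathcomp Require Import all_boot all_order all_algebra.
From mathcomp Require Import all_classical all_reals all_analysis.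
From mathcomp Require Import measurable_realfun ess_sup_inf ring lra.
Import Order.TTheory GRing.Theory Num.Theory.
Import numFieldNormedType.Exports.
Set Implicit Arguments.
Unset Strict Implicit.
Unset Printing Implicit Defensive.
Local Open Scope classical_set_scope.
Local Open Scope ring_scope.

(** Why the rates hold.  Write V for the volume of Omega.  The Euclidean norm
    lies between the maximum norm and d times the maximum norm, so distances
    may be measured in the maximum norm, whose balls are cubes.

    Upper bounds.  A convex Omega contains, around each of its points x, a copy
    of a fixed cube shrunk towards x; hence a uniform point misses the ball of
    radius r around x with probability at most exp(- c r^d), and n independent
    points all miss it with probability at most exp(- c n r^d)
    ([fraction_tail], [prob_far]).  The power of a distance is bounded by a
    series of indicators of the events that the distance exceeds 2^k h
    ([dyadic_bound]), so this tail controls every moment of the distance from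
    x to the sample, at the scale h.
    For gamma < +oo take h = n^(-1/d).  With q the maximum of gamma and alpha,
    the alpha-th power of the norm is at most a constant times
    h^alpha (1 + J), where J is the integral over Omega of 1 plus the series
    ([Lnorm_on_interpolation]); Tonelli's theorem bounds the expectation of J.
    For gamma = +oo take h of order (ln n / n)^(1/d).  A net of Omega of mesh
    at most a multiple of h needs O(n) points ([finite_net]), and for a
    suitable constant in h the tail at each of them is at most 1/n times a
    summable sequence, so that a union bound over the net loses only a
    constant.

    Lower bounds.  For gamma < +oo the bound holds for every sample: n cubes of
    side 2 r cover at most half of Omega when n (2 r)^d = V / 2, and on the
    rest of Omega the distance is at least r.
    For gamma = +oo a cube inside Omega is cut into N cells, with N of order
    n / ln n.  The expected number of cells without a sample point is at least
    1 ([expected_empty_cells]) and the events that two given cells are empty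
    are negatively correlated, so by the second moment method some cell is
    empty with probability at least 1/2 ([second_moment_union]).  The middle of
    an empty cell is a set of positive measure at distance of order
    (ln n / n)^(1/d) from the sample. *)

(** * Integrals and real inequalities *)

Section integral.
Context {dT} {T : measurableType dT} {R : realType}.
Variable m : {measure set T -> \bar R}.

(** The integral of a nonnegative function is a supremum over the simple
    functions below it, so monotonicity holds without measurability.  It lets
    the expected norm be compared with measurable bounds although nothing is
    known about its measurability in the sample point. *)
Lemma ge0_le_integralW (f g : T -> \bar R) :
  (forall x, 0 <= f x)%E -> (forall x, f x <= g x)%E ->
  (\int[m]_x f x <= \int[m]_x g x)%E.
Proof.
move=> f0 fg; have g0 x : (0 <= g x)%E by exact: le_trans (fg x).
rewrite !ge0_integralTE//; apply: ge_ereal_sup => _ [h /= hf <-].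
by apply: ereal_sup_ubound; exists h => //= x; exact: le_trans (fg x).
Qed.

End integral.

Section real_inequalities.
Context {R : realType}.

(** The elementary substitute for Hoelder's inequality between two exponents:
    after rescaling, the constant 1 is absorbed by the volume of Omega. *)
Lemma powR_le_1D (x p q : R) : 0 <= x -> 0 <= p -> p <= q ->
  x `^ p <= 1 + x `^ q.
Proof.
move=> x0 p0 pq; have [x1|x1] := leP x 1.
  apply: (@le_trans _ _ 1); last by rewrite lerDl powR_ge0.
  have h1 : 1 `^ p = 1 by rewrite powR1.
  by rewrite -[leRHS]h1 ge0_ler_powR ?nnegrE.
by apply: (@le_trans _ _ (x `^ q)); [rewrite ler_powR// ltW|rewrite lerDr].
Qed.

Lemma powR_root_expn (d : nat) (x : R) : (0 < d)%N -> 0 <= x -> (x `^ (d%:R^-1)) ^+ d = x.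
Proof.
move=> d0 x0; rewrite -powR_mulrn ?powR_ge0// -powRrM mulVf ?powRr1//.
by rewrite pnatr_eq0 -lt0n.
Qed.

Lemma expR_le_1B (x : R) : 0 <= x <= 2^-1 -> expR (- (2 * x)) <= 1 - x.
Proof.
move=> /andP[x0 x2]; rewrite expRN.
have h1 := expR_ge1Dx (2 * x).
have h2 : 0 < 1 + 2 * x by rewrite ltr_pwDl// mulr_ge0.
apply: (@le_trans _ _ (1 + 2 * x)^-1).
  by rewrite lef_pV2// posrE expR_gt0.
rewrite -[leLHS]mul1r ler_pdivrMr//.
have : 0 <= x * (1 - 2 * x) by rewrite mulr_ge0//; lra.
lra.
Qed.

End real_inequalities.

Section dyadic.
Context {R : realType}.

(** The value of z^q at the right end of the dyadic interval
    2^k < z <= 2^(k+1). *)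
Definition dyadic_weight (q : R) (k : nat) : R := (2 ^+ k.+1) `^ q.

Lemma dyadic_weight_ge0 q k : 0 <= dyadic_weight q k.
Proof. exact: powR_ge0. Qed.

(** If rho > 1 lies in the interval from 2^k to 2^(k+1), the k-th term of the
    series alone exceeds rho^q; the summand 1 takes care of rho <= 1.  This
    replaces the layer cake formula, and only asks for events b k that are
    implied by 2^k < rho. *)
Lemma dyadic_bound (q rho : R) (b : nat -> bool) : 0 < q ->
  (forall k, 2 ^+ k < rho -> b k) ->
  ((rho `^ q)%:E <= 1 + \sum_(k <oo) (dyadic_weight q k * (b k)%:R)%:E)%E.
Proof.
move=> q0 hb.
have t0 k : (0 <= (dyadic_weight q k * (b k)%:R)%:E)%E.
  by rewrite lee_fin mulr_ge0// dyadic_weight_ge0.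
have [rho1|rho1] := leP rho 1.
  apply: (@le_trans _ _ 1%E); last by rewrite leeDl// nneseries_ge0.
  rewrite lee_fin; have [rho0|rho0] := leP 0 rho.
    have <- : 1 `^ q = 1 by rewrite powR1.
    by rewrite ge0_ler_powR ?nnegrE// ltW.
  by rewrite -[leLHS]ger0_norm ?powR_ge0// lt0_norm_powR.
have ex : exists k, rho <= 2 ^+ k.
  exists (Num.bound rho); apply: le_trans (ltW (archi_boundP _)) _ => //.
    by rewrite ltW// (lt_trans _ rho1).
  by rewrite -natrX ler_nat ltnW// ltn_expl.
have [[|k] rk kmin] := ex_minnP ex.
  by move: rk; rewrite expr0 leNgt rho1.
have {}kmin : 2 ^+ k < rho.
  by rewrite ltNge; apply/negP => /kmin; rewrite ltnn.
apply: (@le_trans _ _ (dyadic_weight q k * (b k)%:R)%:E).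
  rewrite (hb _ kmin) mulr1 lee_fin ge0_ler_powR ?nnegrE ?exprn_ge0// ltW//.
  exact: lt_trans rho1.
apply: (@le_trans _ _ (\sum_(k <oo) (dyadic_weight q k * (b k)%:R)%:E)%E).
  apply: le_trans (nneseries_lim_ge k.+1 _); last by move=> *.
  by rewrite big_nat_recr//= leeDr// sume_ge0.
by rewrite leeDr.
Qed.

(** The exponential series dominates each of its terms, so that exp(- a 2^k)
    is at most a constant times 2^(- k (m + 1)) with m >= q; what remains is a
    geometric series of ratio 1/2. *)
Lemma dyadic_series_finite (a q : R) : 0 < a -> 0 < q -> exists2 M : R, 0 <= M &
  (\sum_(k <oo) (dyadic_weight q k * expR (- (a * 2 ^+ k)))%:E <= M%:E)%E.
Proof.
move=> a0 q0.
pose m := Num.bound q.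
have qm : q <= m%:R by apply: ltW; apply: archi_boundP; exact: ltW.
pose C : R := 2 ^+ m * (m.+1`!%:R / a ^+ m.+1).
have C0 : 0 <= C by rewrite mulr_ge0// ?divr_ge0 ?exprn_ge0// ltW.
exists (C *+ 2); first by rewrite mulrn_wge0.
have termle k : dyadic_weight q k * expR (- (a * 2 ^+ k)) <= C / 2 ^+ k.
  have x0 : 0 < a * 2 ^+ k by rewrite mulr_gt0// exprn_gt0.
  apply: (@le_trans _ _ ((2 ^+ k.+1) ^+ m * (m.+1`!%:R / (a * 2 ^+ k) ^+ m.+1))).
    apply: ler_pM; [exact: powR_ge0|exact: expR_ge0| |].
      rewrite -powR_mulrn ?exprn_ge0//; apply: ler_powR => //.
      by rewrite exprn_ege1// ler1n.
    rewrite expRN -[leRHS]invf_div lef_pV2 ?posrE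
       ?expR_gt0 ?divr_gt0 ?exprn_gt0 ?ltr0n ?fact_gt0//.
    by apply: le_trans (expR_ge1Dxn m (ltW x0)); rewrite lerDr.
  rewrite le_eqVlt; apply/orP; left; apply/eqP; rewrite /C exprMn.
  rewrite -exprM mulSn exprD [(2 ^+ k) ^+ _]exprS -exprM.
  field; rewrite ?expf_neq0 ?gt_eqF//.
have := @cvg_geometric_eseries_half R (C *+ 2) 0.
rewrite expr0 divr1 => /cvg_lim <-//.
apply: lee_nneseries => [k _ _|k _].
  by rewrite lee_fin mulr_ge0 ?expR_ge0 ?dyadic_weight_ge0.
rewrite lee_fin; apply: le_trans (termle k) _.
by rewrite natrX addn1 exprS invfM mulrA -[C *+ 2]mulr_natr mulfK.
Qed.

End dyadic.

(** * The maximum norm and Borel sets *)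

Section max_norm.
Context {R : realType} {d : nat}.
Implicit Types x y : 'rV[R]_d.

Lemma rV_norm_leP x (r : R) : 0 <= r ->
  (`|x| <= r) <-> (forall i, `|x ord0 i| <= r).
Proof.
move=> r0; rewrite [`|x|]mx_normrE; split=> [/bigmax_leP[_ xr] i|xr].
  exact: (xr (ord0, i)).
by apply/bigmax_leP; split=> // -[i j] _ /=; rewrite (ord1 i).
Qed.

Lemma rV_coord_le_norm x i : `|x ord0 i| <= `|x|.
Proof. by move: i; apply/rV_norm_leP. Qed.


Lemma norm2_ge x : `|x| <= norm2 x.
Proof.
apply/rV_norm_leP => [|i]; first exact: sqrtr_ge0.
rewrite -sqrtr_sqr ler_wsqrtr// (bigD1 i)//= lerDl.
by apply: sumr_ge0 => j _; exact: sqr_ge0.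
Qed.

Lemma norm2_le x : norm2 x <= d%:R * `|x|.
Proof.
have dx0 : 0 <= d%:R * `|x| by rewrite mulr_ge0.
rewrite /norm2 -[leRHS]ger0_norm// -sqrtr_sqr ler_wsqrtr//.
apply: (@le_trans _ _ (\sum_(i < d) `|x| ^+ 2)).
  apply: ler_sum => i _; rewrite -real_normK ?num_real//.
  by rewrite lerXn2r ?nnegrE// rV_coord_le_norm.
rewrite sumr_const card_ord -[leLHS]mulr_natl exprMn.
apply: ler_wpM2r; first exact: sqr_ge0.
by rewrite -natrX ler_nat; case: (d) => // k; rewrite expnS leq_pmulr.
Qed.

Lemma measurable_norm_le dT (T : measurableType dT) (f g : T -> 'rV[R]_d)
    (r : R) :
  measurable_fun setT f -> measurable_fun setT g ->
  measurable [set t | `|f t - g t| <= r].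
Proof.
move=> mf mg; have [r0|r0] := ltP r 0.
  rewrite (_ : mkset _ = set0); first exact: measurable0.
  by apply/seteqP; split=> t //=; rewrite leNgt (lt_le_trans r0).
rewrite (_ : mkset _ = \bigcap_(i in [set: 'I_d])
   ((fun t => `|f t ord0 i - g t ord0 i|) @^-1` `]-oo, r])).
  apply: fin_bigcap_measurable => // i _; rewrite -[X in measurable X]setTI.
  apply: (_ : measurable_fun setT _) => //.
  apply: measurableT_comp => //; apply: measurable_funB.
    by move/measurable_fun_coordP : mf.
  by move/measurable_fun_coordP : mg.
apply/seteqP; split=> t /=.
  by move/rV_norm_leP => /(_ r0) h i _ /=; rewrite in_itv/=; have := h i; rewrite !mxE.
move=> h; apply/rV_norm_leP => // i; have := h i I.
by rewrite /= in_itv/= !mxE.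
Qed.

(** The sigma-algebra is generated by the coordinates and not by the topology.
    An open set is the union of the balls with rational centre and radius 1/k
    that it contains, and these are countably many. *)
Lemma open_measurable_rV (U : set 'rV[R]_d) : open U -> measurable U.
Proof.
move=> oU.
pose B (p : 'rV[rat]_d * nat) : set 'rV[R]_d :=
  [set y | `|y - map_mx ratr p.1| <= p.2.+1%:R^-1].
pose F p := if `[< B p `<=` U >] then B p else set0.
rewrite (_ : U = \bigcup_p F p).
  apply: countable_bigcupT_measurable; first exact: countableP.
  move=> p; rewrite /F; case: ifP => // _.
  exact: measurable_norm_le.
apply/seteqP; split=> x; last first.
  by move=> [p _]; rewrite /F; case: asboolP => // pU /pU.
move=> Ux; have /nbhs_ballP[e /= e0 xU] : nbhs x U by exact: open_nbhs_nbhs.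
have [k ke] : exists k, k.+1%:R^-1 < e / 2.
  have e2 : 0 < e / 2 by rewrite divr_gt0.
  by have [k _ hk] := near_infty_natSinv_lt (PosNum e2); exists k;
    have := hk k; apply => /=.
have /choice[c cP] i : exists q, `|x ord0 i - ratr q| <= k.+1%:R^-1 :> R.
  have [|q] := @rat_in_itvoo R (x ord0 i - k.+1%:R^-1) (x ord0 i + k.+1%:R^-1).
    by rewrite ltrD2l gtrN// invr_gt0.
  rewrite in_itv/= => /andP[q1 q2]; exists q; rewrite distrC ler_distl.
  by rewrite !ltW.
pose q := \row_i c i.
have xB : B (q, k) x.
  apply/rV_norm_leP => // i; rewrite !mxE; exact: cP.
exists (q, k) => //; rewrite /F; case: asboolP => // -[] y yB.
apply: xU; rewrite -ball_normE /= .
rewrite (_ : x - y = (x - map_mx ratr q) - (y - map_mx ratr q)); last first.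
  by rewrite opprB addrA subrK.
apply: le_lt_trans (ler_normB _ _) _.
have -> : e = e / 2 + e / 2 by rewrite -splitr.
by rewrite ltrD// (le_lt_trans _ ke).
Qed.

End max_norm.

(** * Cubes and grids *)

Section cubes.
Context {R : realType} {d : nat}.
Notation mu := (lebesgue_rV R d).

Definition cube (a : 'rV[R]_d) (l : R) : set 'rV[R]_d :=
  [set x | forall i, a ord0 i <= x ord0 i < a ord0 i + l].

Lemma cubeE a l :
  cube a l = [set x | forall i, `[a ord0 i, a ord0 i + l[%classic (x ord0 i)].
Proof. by apply/seteqP; split=> x /= h i; have := h i; rewrite in_itv. Qed.

Lemma measurable_cube a l : measurable (cube a l).
Proof.
rewrite (_ : cube a l = \bigcap_(i in [set: 'I_d])
   ((fun x : 'rV[R]_d => x ord0 i) @^-1` `[a ord0 i, a ord0 i + l[%classic)).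
  apply: fin_bigcap_measurable => // i _; rewrite -[X in measurable X]setTI.
  exact: measurable_coord.
by rewrite cubeE; apply/seteqP; split=> x /= h i; [move=> _|]; exact: h.
Qed.

Lemma mu_cube a l : 0 <= l -> mu (cube a l) = (l ^+ d)%:E.
Proof.
move=> l0; rewrite cubeE.
rewrite (@lebesgue_rV_box R d (fun i => `[a ord0 i, a ord0 i + l[%classic))//.
under eq_bigr do rewrite lebesgue_measure_itv/= lte_fin ltrDl.
case: ltP => [_|l0'].
  under eq_bigr do rewrite -EFinB addrAC subrr add0r.
  by rewrite prodEFin prodr_const card_ord.
have -> : l = 0 by apply/eqP; rewrite eq_le l0 l0'.
by rewrite expr0n; case: (d) => [|k]; rewrite ?big_ord0// big_ord_recl mul0e.
Qed.

Lemma volE (A : set 'rV[R]_d) : measurable A -> vol A = mu A.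
Proof. by move=> mA; rewrite /vol measurable_mu_extE. Qed.

Lemma measurable_lebesgue (A : set 'rV[R]_d) : measurable A -> lebesgue_measurable A.
Proof.
move=> mA; exists A => //; exists set0; last by rewrite setU0.
exact: negligible_set0.
Qed.

End cubes.

Section grid.
Context {R : realType} {d : nat}.
Implicit Types (b x y : 'rV[R]_d) (L : R).

Definition corner b L m (j : {ffun 'I_d -> 'I_m}) : 'rV[R]_d :=
  \row_i (b ord0 i + L / m%:R * (j i)%:R).

Definition cell b L m (j : {ffun 'I_d -> 'I_m}) : set 'rV[R]_d :=
  cube (corner b L j) (L / m%:R).

Lemma cube_diam b L x y : 0 <= L -> cube b L x -> cube b L y -> `|x - y| <= L.
Proof.
move=> L0 bx bY; apply/rV_norm_leP => // i; rewrite !mxE.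
by have := bx i; have := bY i; rewrite ler_norml; lra.
Qed.

Lemma cell_cover b L m x : 0 < L -> (0 < m)%N -> cube b L x ->
  exists j : {ffun 'I_d -> 'I_m}, cell b L j x.
Proof.
move=> L0 m0 bx; have mR0 : 0 < m%:R :> R by rewrite ltr0n.
pose l := L / m%:R; have l0 : 0 < l by rewrite divr_gt0.
pose u i := (x ord0 i - b ord0 i) / l.
have u0 i : 0 <= u i.
  by rewrite divr_ge0 ?(ltW l0)// subr_ge0; case/andP: (bx i).
have um i : (Num.truncn (u i) < m)%N.
  rewrite -(ltr_nat R); apply: (@le_lt_trans _ _ (u i)).
    by case/andP: (truncn_itv (u0 i)).
  rewrite ltr_pdivrMr// /l mulrC divfK ?gt_eqF//.
  by case/andP: (bx i); lra.
exists [ffun i => Ordinal (um i)] => i; rewrite !mxE ffunE /=.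
have /andP[h1 h2] := truncn_itv (u0 i).
have xE : x ord0 i = b ord0 i + l * u i.
  by rewrite /u mulrC divfK ?gt_eqF// addrC subrK.
rewrite -/l xE -addrA lerD2l ltrD2l ler_pM2l// h1/=.
by rewrite -[X in _ + X]mulr1 -mulrDr ltr_pM2l// natr1.
Qed.

Lemma cell_sub b L m (j : {ffun 'I_d -> 'I_m}) : 0 < L ->
  cell b L j `<=` cube b L.
Proof.
move=> L0 x hx i; have := hx i; rewrite mxE.
have m0 : (0 < m)%N by apply: leq_ltn_trans (ltn_ord (j i)).
have mR0 : 0 < m%:R :> R by rewrite ltr0n.
set l := L / m%:R; have l0 : 0 < l by rewrite divr_gt0.
have LE : L = l * m%:R by rewrite divfK ?gt_eqF.
move=> /andP[h1 h2]; apply/andP; split.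
  by apply: le_trans h1; rewrite lerDl mulr_ge0// ltW.
apply: lt_le_trans h2 _; rewrite -addrA lerD2l -[X in _ + X]mulr1 -mulrDr.
by rewrite LE ler_pM2l// natr1 ler_nat.
Qed.

(** The cells are half-open, which makes them pairwise disjoint and not only
    almost disjoint. *)
Lemma cell_disj b L m (j k : {ffun 'I_d -> 'I_m}) : 0 < L -> j != k ->
  cell b L j `&` cell b L k = set0.
Proof.
move=> L0; apply: contra_neqP => /eqP/set0P[x [xj xk]].
apply/ffunP => i; apply/val_inj => /=.
have m0 : (0 < m)%N by apply: leq_ltn_trans (ltn_ord (j i)).
have l0 : 0 < L / m%:R by rewrite divr_gt0// ltr0n.
have := xj i; have := xk i; rewrite !mxE => /andP[h1 h2] /andP[h3 h4].
have lt_S (p q : nat) : L / m%:R * p%:R < L / m%:R * q%:R + L / m%:R ->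
    (p <= q)%N.
  by rewrite -[X in _ + X]mulr1 -mulrDr ltr_pM2l// natr1 ltr_nat.
by apply/eqP; rewrite eqn_leq !lt_S//; lra.
Qed.

(** One point is picked in each cell that meets Omega, and an arbitrary point
    of Omega for the other cells.  The points lie in Omega itself because the
    tail estimate holds only there. *)
Lemma finite_net (Omega : set 'rV[R]_d) b L m : 0 < L -> (0 < m)%N ->
  Omega !=set0 -> Omega `<=` cube b L ->
  exists p : {ffun 'I_d -> 'I_m} -> 'rV[R]_d,
    (forall j, Omega (p j)) /\
    forall x, Omega x -> exists j, `|x - p j| <= L / m%:R.
Proof.
move=> L0 m0 [x0 Ox0] Ob.
have l0 : 0 <= L / m%:R by rewrite divr_ge0// ltW.
have /choice[p hp] (j : {ffun 'I_d -> 'I_m}) : exists y, Omega y /\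
    forall x, Omega x -> cell b L j x -> `|x - y| <= L / m%:R.
  have [[y [Oy yj]]|H] := pselect (exists y, Omega y /\ cell b L j y).
    by exists y; split=> // x _ xj; exact: cube_diam xj yj.
  by exists x0; split=> // x Ox xj; case: H; exists x.
exists p; split=> [j|x Ox]; first by case: (hp j).
by have [j xj] := cell_cover L0 m0 (Ob _ Ox); exists j; apply hp.
Qed.

End grid.

(** * Cubes in a bounded convex domain *)

(** The probability that a uniformly distributed point of Omega lies in B. *)
Definition fraction (R : realType) (d : nat) (Omega B : set 'rV[R]_d) : R :=
  fine (lebesgue_rV R d (B `&` Omega)) / fine (lebesgue_rV R d Omega).

Section domain.
Context {R : realType} {d : nat}.
Variable Omega : set 'rV[R]_d.
Notation mu := (lebesgue_rV R d).

Lemma bounded_sub_cube : bounded_set Omega ->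
  exists (b : 'rV[R]_d) (L : R), [/\ 0 < L, Omega `<=` cube b L &
    forall x y, Omega x -> Omega y -> `|x - y| <= L].
Proof.
move=> [M [_ hM]]; pose M' := Num.max M 0 + 1.
have M'M : M < M' by rewrite /M' ltr_pwDr// le_max lexx.
have M'0 : 0 < M' by rewrite /M' ltr_pwDr// le_max lexx orbT.
have OM x : Omega x -> `|x| <= M' by move=> Ox; exact: (hM _ M'M).
exists (const_mx (- M')), (M' *+ 3); split; first by rewrite pmulrn_lgt0.
  move=> x /OM xM i; rewrite mxE; have := rV_coord_le_norm x i.
  by move=> /le_trans/(_ xM); rewrite ler_norml; lra.
move=> x y /OM xM /OM yM; apply: le_trans (ler_normB _ _) _; lra.
Qed.

Lemma open_sup_cube : Omega !=set0 -> open Omega ->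
  exists (a : 'rV[R]_d) (s : R), 0 < s /\ cube a s `<=` Omega.
Proof.
move=> [x Ox] oO; have /nbhs_ballP[e /= e0 xO] : nbhs x Omega.
  exact: open_nbhs_nbhs.
exists (x - const_mx (e / 2)), (e / 2); split; first by rewrite divr_gt0.
move=> y hy; apply: xO; rewrite -ball_normE /=.
apply: (@le_lt_trans _ _ (e / 2)); last by lra.
apply/rV_norm_leP => [|i]; first by rewrite divr_ge0// ltW.
have := hy i; rewrite !mxE ler_norml; lra.
Qed.

(** The homothety of centre x and ratio t sends Omega into itself by convexity,
    and it contracts distances to x. *)
Lemma shrunk_cube (a x : 'rV[R]_d) (s t : R) :
  convex_set (Omega : set (convex_lmodType 'rV[R]_d)) ->
  cube a s `<=` Omega -> Omega x -> 0 < t <= 1 ->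
  cube (x + t *: (a - x)) (t * s) `<=`
    Omega `&` [set y | exists2 z, Omega z & x - y = t *: (x - z)].
Proof.
move=> cO aO Ox /andP[t0 t1] y hy.
pose z := x + t^-1 *: (y - x).
have Oz : Omega z.
  apply: aO => i; have := hy i; rewrite !mxE.
  have -> : x ord0 i + t^-1 * (y ord0 i - x ord0 i) =
    t^-1 * (y ord0 i - (x ord0 i + t * (a ord0 i - x ord0 i))) + a ord0 i.
    by field; rewrite gt_eqF.
  move=> /andP[h1 h2]; apply/andP; split.
    by rewrite lerDr mulr_ge0 ?invr_ge0 ?subr_ge0// ltW.
  by rewrite [ltLHS]addrC ltrD2l mulrC ltr_pdivrMr// ltrBlDl [s * t]mulrC.
split; last first.
  exists z => //; apply/rowP => i; rewrite !mxE; field.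
  by rewrite gt_eqF.
pose t' := Itv01 (ltW t0) t1.
have := cO z x t' (mem_set Oz) (mem_set Ox).
rewrite inE; congr Omega.
apply/rowP => i; rewrite !mxE /= /unstable.onem; field.
by rewrite gt_eqF.
Qed.

Hypothesis mOmega : measurable Omega.

Lemma mu_lt_pinfty (b : 'rV[R]_d) (L : R) : 0 <= L ->
  Omega `<=` cube b L -> (mu Omega < +oo)%E.
Proof.
move=> L0 Ob; apply: (@le_lt_trans _ _ (mu (cube b L))).
  by apply: le_measure => //; rewrite inE//; exact: measurable_cube.
by rewrite mu_cube// ltry.
Qed.

Lemma fractionC (C : set 'rV[R]_d) (v : R) : measurable C -> C `<=` Omega ->
  mu C = v%:E -> (mu Omega < +oo)%E -> 0 < fine (mu Omega) ->
  fraction Omega (~` C) = 1 - v / fine (mu Omega).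
Proof.
move=> mC CO muC Ooo V0; rewrite /fraction setIC -setDE measureD//.
rewrite (setIidr CO) fineB; [|by rewrite ge0_fin_numE|by rewrite [X in X \is a _]muC].
by rewrite mulrBl divff ?lt0r_neq0//= muC.
Qed.

(** For r at most the diameter bound L, the ball of radius r around x contains
    the image of the cube of side s under the homothety of ratio r / L, whose
    volume is (s r / L)^d; the exponential comes from 1 - u <= exp(- u).  For
    r > L the ball contains Omega and the fraction vanishes, so that the bound
    holds at all scales. *)
Lemma fraction_tail (a : 'rV[R]_d) (s L : R) :
  convex_set (Omega : set (convex_lmodType 'rV[R]_d)) -> (0 < d)%N ->
  (mu Omega < +oo)%E ->
  0 < s -> cube a s `<=` Omega ->
  0 < L -> (forall x y, Omega x -> Omega y -> `|x - y| <= L) ->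
  exists2 c : R, 0 < c & forall x (r : R), Omega x -> 0 <= r ->
    fraction Omega [set y | r < `|x - y|] <= expR (- (c * r ^+ d)).
Proof.
move=> cO d0 Ooo s0 aO L0 OL.
have sV : s ^+ d <= fine (mu Omega).
  rewrite -lee_fin fineK ?ge0_fin_numE// -(mu_cube a (ltW s0)).
  by apply: le_measure => //; rewrite inE//; exact: measurable_cube.
have V0 : 0 < fine (mu Omega) by apply: lt_le_trans sV; rewrite exprn_gt0.
exists ((s / L) ^+ d / fine (mu Omega)).
  by rewrite divr_gt0// exprn_gt0// divr_gt0.
move=> x r Ox r0.
have mB : measurable [set y | r < `|x - y|].
  rewrite (_ : mkset _ = ~` [set y | `|x - y| <= r]).
    by apply: measurableC; apply: measurable_norm_le.
  by apply/seteqP; split=> y /=; rewrite real_ltNge ?num_real//; move/negP.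
have [Lr|rL] := ltP L r.
  rewrite /fraction (_ : _ `&` _ = set0) ?measure0 ?mul0r ?expR_ge0//.
  apply/seteqP; split=> y //= [ry Oy].
  by have := OL _ _ Ox Oy; rewrite leNgt (lt_trans Lr).
have fineO E : measurable E -> E `<=` Omega -> mu E \is a fin_num.
  move=> mE EO; rewrite ge0_fin_numE//; apply: le_lt_trans Ooo.
  by apply: le_measure; rewrite ?inE.
(* Any subset of the ball bounds the fraction; it will be empty for r = 0. *)
have key Q : measurable Q -> Q `<=` Omega `&` [set y | `|x - y| <= r] ->
    fraction Omega [set y | r < `|x - y|] <=
    1 - fine (mu Q) / fine (mu Omega).
  move=> mQ QO.
  have mBO := measurableI _ _ mB mOmega.
  rewrite -[X in X - _](divff (lt0r_neq0 V0)) -mulrBl ler_pM2r ?invr_gt0//.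
  rewrite lerBrDr -lee_fin EFinD !fineK ?fineO//; last by move=> y /QO[].
  rewrite -measureU//; last first.
    by apply/seteqP; split=> y //= [[ry _] /QO[_ /=]]; rewrite leNgt ry.
  apply: le_measure; rewrite ?inE//; first exact: measurableU.
  by move=> y [[]|/QO[]].
have [req0|r_neq0] := eqVneq r 0.
  rewrite [in leRHS]req0 expr0n -[(d == 0)%N]negbK -lt0n d0 mulr0 oppr0 expR0.
  apply: le_trans (key set0 measurable0 (@sub0set _ _)) _.
  by rewrite measure0 mul0r subr0.
have {}r0 : 0 < r by rewrite lt_neqAle eq_sym r_neq0.
pose t := r / L.
have t01 : 0 < t <= 1 by rewrite divr_gt0//= ler_pdivrMr// mul1r.
have tL : t * L = r by rewrite divfK// gt_eqF.
have := shrunk_cube cO aO Ox t01.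
set Q := cube _ _ => QO.
have QB : Q `<=` Omega `&` [set y | `|x - y| <= r].
  move=> y /QO [Oy [z Oz /= ->]]; split=> //=.
  have t0 : 0 <= t by case/andP: t01 => /ltW.
  by rewrite normrZ ger0_norm// -tL ler_wpM2l// OL.
apply: le_trans (key _ (measurable_cube _ _) QB) _.
rewrite mu_cube /=; last by rewrite mulr_ge0// ltW//; case/andP: t01.
apply: le_trans (expR_ge1Dx _).
by rewrite lerD2l lerN2 mulrAC -exprMn mulrAC [s * r]mulrC mulrAC.
Qed.

End domain.

(** * Distance to a random sample *)

Section sampling.
Context {dT} {T : measurableType dT} {R : realType} {P : probability T R}.
Context {d : nat}.
Variable X : nat -> {RV P >-> 'rV[R]_d}.
Notation mu := (lebesgue_rV R d).

Lemma dist_sample_le n w x i : (i < n)%N ->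
  dist x (sample X n w) <= d%:R * `|x - X i w|.
Proof.
move=> ni; apply: le_trans (norm2_le _); apply: ge_inf.
  by exists 0 => _ [y _ <-]; exact: sqrtr_ge0.
by exists (X i w) => //; exists i.
Qed.

Lemma dist_sample_ge n w x (r : R) : (0 < n)%N ->
  (forall i, (i < n)%N -> r <= `|x - X i w|) -> r <= dist x (sample X n w).
Proof.
move=> n0 xr; apply: lb_le_inf.
  by exists (norm2 (x - X 0 w)), (X 0 w) => //; exists 0.
move=> _ [_ [i /= ni <-] <-]; apply: le_trans (norm2_ge _); exact: xr.
Qed.

Lemma dist_sample_ge0 n w x : (0 < n)%N -> 0 <= dist x (sample X n w).
Proof. by move=> n0; exact: dist_sample_ge. Qed.

Variable Omega : set 'rV[R]_d.
Hypothesis mOmega : measurable Omega.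
Hypothesis unifX : forall i, uniformly_distributed (X i) Omega.
Hypothesis indepX : independent X.

Lemma prob_forall B n : measurable B ->
  P [set w | forall i, (i < n)%N -> B (X i w)] = (fraction Omega B ^+ n)%:E.
Proof.
move=> mB; have := indepX (B := fun=> B) (iota_uniq 0 n) (fun _ _ => mB).
rewrite (_ : \bigcap_(i in _) _ = [set w | forall i, (i < n)%N -> B (X i w)]).
  move=> ->; rewrite (eq_bigr (fun=> (fraction Omega B)%:E)) => [|i _].
    rewrite prodEFin -{1}(subn0 n) -/(index_iota 0 n).
    by rewrite prodr_const_nat subn0.
  rewrite unifX.
  - by rewrite !volE//; exact: measurableI.
  - exact: measurable_lebesgue.
  - by rewrite -[X in measurable X]setTI; exact: measurable_funPT.
apply/seteqP; split=> w /= h i ni; first by apply: h; rewrite /= mem_iota.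
by move: ni; rewrite /= mem_iota => /andP[_ ni]; exact: h.
Qed.

End sampling.

Section far.
Context {dT} {T : measurableType dT} {R : realType} {P : probability T R}.
Context {d : nat}.
Variable X : nat -> {RV P >-> 'rV[R]_d}.

Definition far n (x : 'rV[R]_d) (r : R) : set T :=
  [set w | forall i, (i < n)%N -> r < `|x - X i w|].

(** Centre and outcome both depend on a parameter, so that the lemma gives
    joint measurability on the product space as well as measurability for a
    fixed centre. *)
Lemma measurable_far dS (S : measurableType dS) n (f : S -> 'rV[R]_d)
   (g : S -> T) (r : R) :
  measurable_fun setT f -> measurable_fun setT g ->
  measurable [set s | far n (f s) r (g s)].
Proof.
move=> mf mg.
rewrite (_ : mkset _ =
   \bigcap_(i in `I_n) ~` [set s | `|f s - X i (g s)| <= r]).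
  apply: bigcap_measurableType => i _; apply: measurableC.
  apply: measurable_norm_le => //.
  by apply: measurableT_comp => //; exact: measurable_funPT.
apply/seteqP; split=> s /= h i ni.
  by move=> /=; rewrite leNgt h.
by rewrite ltNge; apply/negP; exact: h.
Qed.

(** The dyadic series of [dyadic_bound] for the distance from x to the sample,
    measured at the scale h. *)
Definition far_series n (h q : R) (w : T) (x : 'rV[R]_d) : \bar R :=
  \sum_(k <oo) (dyadic_weight q k * \1_(far n x (2 ^+ k * h)) w)%:E.

Lemma far_series_ge0 n h q w x : (0 <= far_series n h q w x)%E.
Proof.
apply: nneseries_ge0 => k _ _.
by rewrite lee_fin mulr_ge0// dyadic_weight_ge0.
Qed.

Lemma measurable_far_series dS (S : measurableType dS) n (h q : R)
    (f : S -> 'rV[R]_d) (g : S -> T) :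
  measurable_fun setT f -> measurable_fun setT g ->
  measurable_fun setT (fun s => far_series n h q (g s) (f s)).
Proof.
move=> mf mg; apply: (ge0_emeasurable_sum (P := xpredT)) => [k s _ _|k _].
  by rewrite lee_fin mulr_ge0// dyadic_weight_ge0.
apply/measurable_EFinP; apply: measurable_funM => //.
rewrite (_ : (fun _ => _) = \1_[set s | far n (f s) (2 ^+ k * h) (g s)]).
  by apply: measurable_indic; exact: measurable_far.
by apply/funext => s; rewrite !indicE; congr (_%:R); rewrite !in_setE.
Qed.

(** The distance is evaluated at x but the series at a nearby point y: in the
    supremum norm y is a point of a net, in the other norms y = x and e = 0. *)
Lemma dist_sample_dyadic n w x y (h q e : R) : (0 < n)%N -> (0 < d)%N ->
  0 < h -> 0 < q -> 0 <= e -> `|x - y| <= e * h ->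
  (((dist x (sample X n w)) `^ q)%:E <=
   ((d%:R * (1 + e) * h) `^ q)%:E * (1 + far_series n h q w y))%E.
Proof.
move=> n0 d0 h0 q0 e0 xy; set D := dist _ _.
have dR0 : 0 < d%:R :> R by rewrite ltr0n.
have D0 : 0 <= D by exact: dist_sample_ge0.
have e1 : 0 < 1 + e by rewrite ltr_pwDl.
have r0 : 0 < d%:R * (1 + e) * h by rewrite !mulr_gt0.
(* A sample point within 2^k h of y would put x within d (e + 2^k) h of it. *)
pose rho := D / d%:R / h - e.
have DE : D = d%:R * h * (rho + e).
  by rewrite /rho subrK; field; rewrite !gt_eqF.
have series_ge : ((rho `^ q)%:E <= 1 + far_series n h q w y)%E.
  rewrite /far_series; under eq_eseriesr do rewrite indicE.
  apply: dyadic_bound => // k hk; rewrite mem_set// => i ni.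
  have Dxi : D / d%:R <= `|x - X i w|.
    by rewrite ler_pdivrMr// mulrC; exact: dist_sample_le.
  have xyi : `|x - X i w| <= `|x - y| + `|y - X i w| by exact: ler_distD.
  have : 2 ^+ k * h < (D / d%:R / h - e) * h by rewrite ltr_pM2r.
  by rewrite mulrBl divfK ?gt_eqF//; lra.
have [rho1|rho1] := leP rho 1.
  apply: (@le_trans _ _ ((d%:R * (1 + e) * h) `^ q)%:E); last first.
    rewrite -[leLHS]mule1 lee_pmul2l// ?lte_fin ?powR_gt0//.
    by rewrite leeDl// far_series_ge0.
  rewrite lee_fin ge0_ler_powR ?nnegrE ?(ltW q0) ?(ltW r0)//.
  by rewrite DE mulrAC ler_pM2r// ler_pM2l// lerD2r.
apply: (@le_trans _ _ ((d%:R * (1 + e) * h) `^ q * rho `^ q)%:E); last first.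
  by rewrite EFinM lee_pmul2l// lte_fin powR_gt0.
have rho0 : 0 <= rho by rewrite ltW// (lt_trans _ rho1).
rewrite -powRM ?(ltW r0)// lee_fin ge0_ler_powR ?nnegrE ?(ltW q0)//.
  by rewrite mulr_ge0// ltW.
have -> : d%:R * (1 + e) * h * rho = d%:R * h * ((1 + e) * rho) by ring.
rewrite DE ler_pM2l ?mulr_gt0//.
suff : 0 <= e * (rho - 1) by lra.
by rewrite mulr_ge0// subr_ge0 ltW.
Qed.

End far.

Section far_expectation.
Context {dT} {T : measurableType dT} {R : realType} {P : probability T R}.
Context {d : nat}.
Variable X : nat -> {RV P >-> 'rV[R]_d}.
Variable Omega : set 'rV[R]_d.
Hypothesis mOmega : measurable Omega.
Hypothesis unifX : forall i, uniformly_distributed (X i) Omega.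
Hypothesis indepX : independent X.
Variable c : R.
Hypothesis tail : forall x (r : R), Omega x -> 0 <= r ->
  fraction Omega [set y | r < `|x - y|] <= expR (- (c * r ^+ d)).

Lemma measurable_far_pt n x (r : R) : measurable (far X n x r).
Proof.
exact: (@measurable_far _ _ _ _ _ X _ T n (fun=> x) id).
Qed.

Lemma prob_far n x (r : R) : Omega x -> 0 <= r ->
  (P (far X n x r) <= (expR (- (c * (n%:R * r ^+ d))))%:E)%E.
Proof.
move=> Ox r0; rewrite [X in P X](_ : _ =
  [set w | forall i, (i < n)%N -> [set y | r < `|x - y|] (X i w)])//.
rewrite (prob_forall mOmega unifX indepX); last first.
  rewrite (_ : mkset _ = ~` [set y | `|x - y| <= r]).
    by apply: measurableC; apply: measurable_norm_le.
  by apply/seteqP; split=> y /=; rewrite real_ltNge ?num_real//; move/negP.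
rewrite lee_fin mulrCA -mulrN expRM_natl lerXn2r ?nnegrE ?expR_ge0 ?tail//.
by rewrite divr_ge0// fine_ge0.
Qed.

(** The d-th power of the radius 2^k h is at least 2^k h^d, which brings the
    tails to the form of [dyadic_series_finite]. *)
Lemma expectation_far_series n x (h q : R) : (0 < d)%N -> 0 <= c -> 0 < h ->
  Omega x ->
  (\int[P]_w far_series X n h q w x <=
   \sum_(k <oo)
      (dyadic_weight q k * expR (- (c * (n%:R * h ^+ d) * 2 ^+ k)))%:E)%E.
Proof.
have mt k : measurable_fun setT (fun w =>
    (dyadic_weight q k * \1_(far X n x (2 ^+ k * h)) w)%:E).
  apply/measurable_EFinP; apply: measurable_funM => //.
  by apply: measurable_indic; exact: measurable_far_pt.
have t0 k w : (0 <= (dyadic_weight q k * \1_(far X n x (2 ^+ k * h)) w)%:E)%E.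
  by rewrite lee_fin mulr_ge0// dyadic_weight_ge0.
move=> d0 c0 h0 Ox; rewrite integral_nneseries//.
apply: lee_nneseries => [k _ _|k _]; first exact: integral_ge0.
under eq_integral do rewrite EFinM.
rewrite ge0_integralZl//; last 2 first.
- by apply/measurable_EFinP; apply: measurable_indic; exact: measurable_far_pt.
- by rewrite lee_fin dyadic_weight_ge0.
rewrite integral_indic//; last exact: measurable_far_pt.
rewrite setIT EFinM lee_wpmul2l ?lee_fin ?dyadic_weight_ge0//.
have r0 : 0 <= 2 ^+ k * h by rewrite mulr_ge0 ?exprn_ge0// ltW.
apply: le_trans (prob_far n Ox r0) _.
rewrite lee_fin ler_expR lerN2 -!mulrA ler_wpM2l// ler_wpM2l//.
rewrite exprMn mulrC ler_wpM2r ?exprn_ge0 ?(ltW h0)//.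
by rewrite -exprM ler_weXn2l ?ler1n// leq_pmulr.
Qed.

End far_expectation.

(** * Bounds on Lebesgue norms *)

Section interpolation.
Context {R : realType} {d : nat}.
Notation mu := (lebesgue_rV R d).
Variable Omega : set 'rV[R]_d.
Hypothesis mOmega : measurable Omega.
Hypothesis Ooo : (mu Omega < +oo)%E.

(** With J the integral of G, the proof compares g with the scale lam given by
    lam^q = r^q (1 + J), which bounds the norm by a multiple of lam.  As
    alpha <= q, the power (1 + J)^(alpha / q) is at most 1 + J: the bound is
    linear in G, so that Tonelli's theorem gives its expectation. *)
Lemma Lnorm_on_interpolation (gamma q alpha r : R) (g : 'rV[R]_d -> R)
    (G : 'rV[R]_d -> \bar R) :
  0 < gamma -> gamma <= q -> 0 < alpha -> alpha <= q -> 0 < r ->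
  (forall x, 0 <= g x) -> (forall x, 0 <= G x)%E -> measurable_fun setT G ->
  (forall x, Omega x -> (g x `^ q)%:E <= (r `^ q)%:E * G x)%E ->
  (poweR (Lnorm_on Omega gamma%:E g) alpha <=
   (r `^ alpha * (fine (mu Omega) + 1) `^ (alpha / gamma))%:E *
   (1 + \int[mu]_(x in Omega) G x))%E.
Proof.
move=> gamma0 gq alpha0 aq r0 g0 G0 mG gG.
set J := (\int[mu]_(x in Omega) G x)%E; set V := fine (mu Omega).
have V0 : 0 <= V by rewrite fine_ge0.
have q0 : 0 < q by exact: lt_le_trans gq.
have J0 : (0 <= J)%E by exact: integral_ge0.
have K0 : 0 < r `^ alpha * (V + 1) `^ (alpha / gamma).
  by rewrite mulr_gt0// powR_gt0// ltr_wpDl.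
(* The claim is trivial when the right-hand side is infinite. *)
have [Joo|] := eqVneq J +oo%E.
  by rewrite Joo addey// gt0_muley ?leey// lte_fin.
rewrite -ltey -ge0_fin_numE// => /fineK Jfin.
set j := fine J in Jfin; have j0 : 0 <= j by rewrite fine_ge0.
have j1 : 0 < 1 + j by rewrite ltr_wpDr.
pose lam := r * (1 + j) `^ q^-1.
have lam0 : 0 < lam by rewrite mulr_gt0// powR_gt0.
have lamq : lam `^ q = r `^ q * (1 + j).
  rewrite powRM ?powR_ge0 ?(ltW r0)// -powRrM mulVf ?gt_eqF// powRr1//.
  exact: ltW.
have ptw x : (((g x * \1_Omega x) `^ gamma)%:E <= (lam `^ gamma)%:E *
    ((\1_Omega x)%:E + ((1 + j)^-1)%:E * (G x * (\1_Omega x)%:E)))%E.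
  rewrite indicE; have [|nOx] := boolP (x \in Omega); last first.
    by rewrite mulr0 powR0 ?gt_eqF// mule0 mule0 adde0 mule0.
  rewrite inE => Ox; rewrite mulr1 mule1.
  have -> : g x = lam * (g x / lam) by rewrite mulrC divfK// gt_eqF.
  have gl0 : 0 <= g x / lam by rewrite divr_ge0// ltW.
  rewrite powRM// ?(ltW lam0)// EFinM lee_pmul2l// ?lte_fin ?powR_gt0//.
  apply: (@le_trans _ _ (1 + (g x / lam) `^ q)%:E).
    by rewrite lee_fin powR_le_1D// ltW.
  rewrite EFinD leeD2l//.
  have -> : (g x / lam) `^ q = (1 + j)^-1 * ((r `^ q)^-1 * g x `^ q).
    rewrite powRM ?invr_ge0// ?(ltW lam0)//.
    rewrite -powR_inv1 ?(ltW lam0)// -powRrM mulN1r powRN lamq invfM.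
    by rewrite mulrCA mulrC mulrA [RHS]mulrC mulrA.
  rewrite EFinM lee_pmul2l// ?lte_fin ?invr_gt0//.
  by rewrite EFinM lee_pdivrMl// ?powR_gt0// gG.
have int_le : (\int[mu]_x ((g x * \1_Omega x) `^ gamma)%:E <=
    (lam `^ gamma * (V + 1))%:E)%E.
  apply: le_trans (ge0_le_integralW _ _ ptw) _.
    by move=> x; rewrite lee_fin powR_ge0.
  have mG1 : measurable_fun setT (fun x => G x * (\1_Omega x)%:E)%E.
    apply: emeasurable_funM => //; apply/measurable_EFinP.
    exact: measurable_indic.
  have GO0 x : (0 <= G x * (\1_Omega x)%:E)%E by rewrite mule_ge0// lee_fin.
  have j1V : (0 <= ((1 + j)^-1)%:E)%E by rewrite lee_fin invr_ge0 ltW.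
  have mO1 : measurable_fun setT (fun x => (\1_Omega x)%:E : \bar R).
    by apply/measurable_EFinP; exact: measurable_indic.
  rewrite ge0_integralZl//; last 3 first.
  - by apply: emeasurable_funD => //; exact: measurable_funeM.
  - by move=> x _; rewrite adde_ge0 ?lee_fin// mule_ge0.
  - by rewrite lee_fin powR_ge0.
  rewrite ge0_integralD//; last 2 first.
  - by move=> x _; rewrite mule_ge0.
  - exact: measurable_funeM.
  rewrite integral_indic// setIT ge0_integralZl//.
  have -> : (\int[mu]_x (G x * (\1_Omega x)%:E) = J)%E.
    by rewrite /J [RHS]integral_mkcond epatch_indic.
  rewrite -Jfin -EFinM.
  rewrite [leRHS]EFinM lee_pmul2l//; last by rewrite lte_fin powR_gt0.
  rewrite [X in (X + _)%E](_ : _ = V%:E); last by rewrite fineK ?ge0_fin_numE.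
  rewrite -EFinD lee_fin lerD2l.
  by rewrite mulrC ler_pdivrMr// mul1r lerDr.
have Lle : (Lnorm_on Omega gamma%:E g <= (lam * (V + 1) `^ gamma^-1)%:E)%E.
  rewrite /Lnorm_on unlock.
  have -> : lam * (V + 1) `^ gamma^-1 = (lam `^ gamma * (V + 1)) `^ gamma^-1.
    rewrite powRM ?powR_ge0// ?addr_ge0// -powRrM mulfV ?gt_eqF// powRr1//.
    exact: ltW.
  rewrite -poweR_EFin; apply: gt0_ler_poweR; rewrite ?invr_ge0 ?(ltW gamma0)//.
  - by rewrite in_itv/= leey andbT; exact: integral_ge0.
  - by rewrite in_itv/= leey andbT lee_fin mulr_ge0 ?powR_ge0// addr_ge0.
  apply: le_trans int_le; rewrite le_eqVlt; apply/orP; left; apply/eqP.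
  apply: eq_integral => x _; rewrite /= ger0_norm// mulr_ge0//.
apply: le_trans (gt0_ler_poweR (ltW alpha0) _ _ Lle) _.
- by rewrite in_itv/= leey andbT Lnorm_ge0.
- by rewrite in_itv/= leey andbT lee_fin mulr_ge0 ?powR_ge0// ltW.
rewrite poweR_EFin -Jfin -EFinD -EFinM lee_fin.
rewrite /lam !powRM ?mulr_ge0 ?powR_ge0 ?(ltW r0)//.
rewrite -!powRrM -mulrA [X in _ * X]mulrC mulrA [gamma^-1 * _]mulrC.
rewrite ler_wpM2l ?(ltW K0)//.
rewrite -[leRHS]powRr1 ?(ltW j1)// ler_powR ?lerDl//.
by rewrite mulrC ler_pdivrMr// mul1r.
Qed.
End interpolation.

Section Lnorm_infinite.
Context {R : realType} {d : nat}.
Variable Omega : set 'rV[R]_d.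

Lemma Lnorm_on_infty_le (alpha r : R) (g : 'rV[R]_d -> R) (S : \bar R) :
  0 < alpha -> 0 <= r -> (0 <= S)%E -> (forall x, 0 <= g x) ->
  (forall x, Omega x -> (g x `^ alpha)%:E <= (r `^ alpha)%:E * S)%E ->
  (poweR (Lnorm_on Omega +oo%E g) alpha <= (r `^ alpha)%:E * S)%E.
Proof.
move=> alpha0 r0 S0 g0 gS; set Z := (_ * S)%E.
have Z0 : (0 <= Z)%E by rewrite mule_ge0// lee_fin powR_ge0.
have aV : 0 <= alpha^-1 by rewrite invr_ge0 ltW.
have aVa : alpha^-1 * alpha = 1 by rewrite mulVf// gt_eqF.
have <- : poweR (poweR Z alpha^-1) alpha = Z.
  by rewrite -poweRrM aVa poweRe1.
apply: gt0_ler_poweR; rewrite ?in_itv/= ?leey ?andbT ?poweR_ge0 ?Lnorm_ge0//.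
  exact: ltW.
rewrite /Lnorm_on unlock; case: ifP => _; last exact: poweR_ge0.
apply/ess_supP; apply: nearW => x /=.
rewrite ger0_norm; last by rewrite mulr_ge0.
rewrite indicE; have [Ox|_] := boolP (x \in Omega); last first.
  by rewrite mulr0 poweR_ge0.
rewrite mulr1 -[g x]powRr1// -(mulfV (lt0r_neq0 alpha0)) powRrM -poweR_EFin.
rewrite inE in Ox.
apply: gt0_ler_poweR => //; rewrite ?in_itv/= ?leey ?andbT//.
  by rewrite lee_fin powR_ge0.
exact: gS.
Qed.

End Lnorm_infinite.

Section Lnorm_lower.
Context {R : realType} {d : nat}.
Notation mu := (lebesgue_rV R d).
Variables Omega B : set 'rV[R]_d.
Hypothesis mB : measurable B.
Hypothesis BO : B `<=` Omega.
Variables (g : 'rV[R]_d -> R) (r : R).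
Hypothesis r0 : 0 <= r.
Hypothesis g0 : forall x, 0 <= g x.
Hypothesis gB : forall x, B x -> r <= g x.

Lemma Lnorm_on_ge_finite (gamma v : R) : 0 < gamma -> 0 <= v ->
  (v%:E <= mu B)%E ->
  ((r * v `^ gamma^-1)%:E <= Lnorm_on Omega gamma%:E g)%E.
Proof.
move=> gamma0 v0 vB; rewrite /Lnorm_on unlock.
have -> : r * v `^ gamma^-1 = (r `^ gamma * v) `^ gamma^-1.
  by rewrite powRM ?powR_ge0// -powRrM mulfV ?gt_eqF// powRr1.
rewrite -poweR_EFin.
have rv0 : (0 <= (r `^ gamma * v)%:E)%E by rewrite lee_fin mulr_ge0 ?powR_ge0.
have le1 : ((r `^ gamma * v)%:E <=
    \int[mu]_x (`|(g x * \1_Omega x)%:E| `^ gamma))%E.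
  apply: (@le_trans _ _ (\int[mu]_x ((r `^ gamma)%:E * (\1_B x)%:E))%E).
    rewrite ge0_integralZl//; last 2 first.
    - by apply/measurable_EFinP; exact: measurable_indic.
    - by rewrite lee_fin powR_ge0.
    by rewrite integral_indic// setIT EFinM lee_wpmul2l// lee_fin powR_ge0.
  apply: ge0_le_integralW => x.
    by rewrite mule_ge0// lee_fin// powR_ge0.
  rewrite [\1_B x]indicE; have [Bx|_] := boolP (x \in B); last first.
    by rewrite mule0 poweR_ge0.
  rewrite inE in Bx; rewrite mule1 indicE mem_set ?mulr1; last exact: BO.
  rewrite abse_EFin ger0_norm// poweR_EFin lee_fin ge0_ler_powR ?nnegrE//.
    exact: ltW.
  exact: gB.
apply: gt0_ler_poweR; rewrite ?in_itv/= ?leey ?andbT//.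
  by rewrite invr_ge0 ltW.
exact: le_trans le1.
Qed.

Lemma Lnorm_on_ge_infinite : (0 < mu B)%E ->
  (r%:E <= Lnorm_on Omega +oo%E g)%E.
Proof.
move=> muB; rewrite /Lnorm_on unlock.
have muT : (0 < mu [set: 'rV[R]_d])%E.
  by apply: lt_le_trans muB _; apply: le_measure; rewrite ?inE.
rewrite muT; set f := (_ \o _).
rewrite leNgt; apply/negP => fr.
have [N [mN N0 fN]] := ess_sup_ge mu f.
have : (mu B <= mu N)%E.
  apply: le_measure; rewrite ?inE// => x Bx; apply: fN => /= xs.
  have := le_lt_trans xs fr.
  rewrite /f /= indicE mem_set; last exact: BO.
  by rewrite mulr1 ger0_norm// lte_fin ltNge gB.
by rewrite N0 leNgt muB.
Qed.

End Lnorm_lower.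

(** * Upper bounds *)

Section upper_finite.
Context {R : realType} {d : nat}.
Notation mu := (lebesgue_rV R d).
Variable Omega : set 'rV[R]_d.
Hypothesis mOmega : measurable Omega.
Hypothesis Ooo : (mu Omega < +oo)%E.
Hypothesis d0 : (0 < d)%N.
Variable c : R.
Hypothesis c0 : 0 < c.
Hypothesis tail : forall x (r : R), Omega x -> 0 <= r ->
  fraction Omega [set y | r < `|x - y|] <= expR (- (c * r ^+ d)).

(** The scale h = n^(-1/d) makes the exponent c n h^d of the tail independent
    of n. *)
Lemma expectation_upper_finite (alpha gamma : R) : 0 < alpha -> 0 < gamma ->
  exists2 C : R, 0 < C &
  forall (dT : measure_display) (T : measurableType dT)
      (P : probability T R) (X : nat -> {RV P >-> 'rV[R]_d}),
    (forall i, uniformly_distributed (X i) Omega) -> independent X ->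
    forall n, (0 < n)%N ->
    (\int[P]_w (poweR (Lnorm_on Omega gamma%:E
                 (fun x => dist x (sample X n w))) alpha)
     <= (C * n%:R `^ (- (alpha / d%:R)))%:E)%E.
Proof.
move=> alpha0 gamma0; pose q := Num.max gamma alpha.
have gq : gamma <= q by rewrite le_max lexx.
have aq : alpha <= q by rewrite le_max lexx orbT.
have q0 : 0 < q by exact: lt_le_trans gq.
have [M M0 hM] := dyadic_series_finite c0 q0.
pose V := fine (mu Omega); have V0 : 0 <= V by rewrite fine_ge0.
have VE : mu Omega = V%:E by rewrite fineK// ge0_fin_numE.
have V1 : 0 < V + 1 by rewrite ltr_wpDl.
exists (d%:R `^ alpha * (V + 1) `^ (alpha / gamma) * (1 + (1 + M) * V)).
  rewrite !mulr_gt0 ?powR_gt0 ?ltr0n//.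
  by rewrite ltr_pwDl// mulr_ge0// addr_ge0.
move=> dT T P X unifX indepX n n0.
have nR0 : 0 < n%:R :> R by rewrite ltr0n.
pose h : R := n%:R^-1 `^ (d%:R^-1).
have h0 : 0 < h by rewrite powR_gt0// invr_gt0.
have hd : n%:R * h ^+ d = 1 by rewrite powR_root_expn ?mulfV ?gt_eqF// ltW.
have dh0 : 0 < d%:R * h by rewrite mulr_gt0// ltr0n.
pose G w x := (1 + far_series X n h q w x)%E.
have mGx w : measurable_fun setT (G w).
  by apply: emeasurable_funD => //; exact: measurable_far_series.
have G0 w x : (0 <= G w x)%E by rewrite adde_ge0// far_series_ge0.
pose F (z : T * 'rV[R]_d) := (G z.1 z.2 * (\1_Omega z.2)%:E)%E.
have GO0 w x : (0 <= G w x * (\1_Omega x)%:E)%E.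
  by rewrite mule_ge0 ?lee_fin.
have mF : measurable_fun setT F.
  apply: emeasurable_funM.
    by apply: emeasurable_funD => //; exact: measurable_far_series.
  by apply/measurable_EFinP; apply: measurableT_comp => //; exact: measurable_indic.
have FE w : (\int[mu]_(x in Omega) G w x = \int[mu]_x F (w, x))%E.
  by rewrite integral_mkcond epatch_indic.
have F_le : (\int[P]_w \int[mu]_x F (w, x) <= ((1 + M) * V)%:E)%E.
  rewrite (fubini_tonelli F mF); last by move=> z; exact: GO0.
  apply: (@le_trans _ _ (\int[mu]_x ((1 + M)%:E * (\1_Omega x)%:E))%E); last first.
    rewrite ge0_integralZl//; last 2 first.
    - by apply/measurable_EFinP; exact: measurable_indic.
    - by rewrite lee_fin addr_ge0.
    by rewrite integral_indic// setIT EFinM [X in (_ * X <= _)%E]VE.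
  apply: ge0_le_integralW => x; first by apply: integral_ge0 => w _; exact: GO0.
  rewrite /F /= indicE; have [Ox|_] := boolP (x \in Omega); last first.
    under eq_integral do rewrite mule0.
    by rewrite integral0 mule0.
  under eq_integral do rewrite mule1.
  rewrite mule1; rewrite inE in Ox.
  rewrite ge0_integralD//; last 2 first.
  - by move=> w _; exact: far_series_ge0.
  - exact: measurable_far_series.
  rewrite integral_cst// mul1e [X in (X + _)%E]probability_setT EFinD leeD2l//.
  apply: le_trans (expectation_far_series mOmega unifX indepX tail n q d0
    (ltW c0) h0 Ox) _.
  by rewrite hd mulr1.
pose K := (d%:R * h) `^ alpha * (V + 1) `^ (alpha / gamma).
have K0 : 0 <= K by rewrite mulr_ge0 ?powR_ge0.
have ptw w : (poweR (Lnorm_on Omega gamma%:E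
     (fun x => dist x (sample X n w))) alpha <=
     K%:E * (1 + \int[mu]_x F (w, x)))%E.
  rewrite -FE; apply: (Lnorm_on_interpolation mOmega Ooo gamma0 gq alpha0 aq dh0) => //.
  - by move=> x; exact: dist_sample_ge0.
  - move=> x _; have := @dist_sample_dyadic _ _ _ _ _ X n w x x h q 0.
    by rewrite addr0 mulr1 subrr normr0 mul0r; exact.
apply: le_trans (ge0_le_integralW _ (fun=> poweR_ge0 _ _) ptw) _.
have mI : measurable_fun setT (fun w => \int[mu]_x F (w, x))%E.
  by apply: (measurable_fun_fubini_tonelli_F F mF) => z; exact: GO0.
have I0 w : (0 <= \int[mu]_x F (w, x))%E.
  by apply: integral_ge0 => x _; exact: GO0.
rewrite ge0_integralZl//; last 2 first.
- exact: emeasurable_funD.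
- by move=> w _; rewrite adde_ge0.
rewrite ge0_integralD//.
rewrite integral_cst// mul1e [X in (_ * (X + _))%E]probability_setT.
apply: (@le_trans _ _ (K%:E * (1 + ((1 + M) * V)%:E))%E).
  by rewrite lee_wpmul2l ?lee_fin// leeD2l.
rewrite -EFinD -EFinM lee_fin le_eqVlt; apply/orP; left; apply/eqP.
rewrite /K powRM ?(ltW h0)// /h -powR_inv1 ?(ltW nR0)// -!powRrM.
rewrite mulN1r [_^-1 * alpha]mulrC.
by ring.
Qed.

End upper_finite.

Section upper_infinite.
Context {R : realType} {d : nat}.
Notation mu := (lebesgue_rV R d).
Variable Omega : set 'rV[R]_d.
Hypothesis mOmega : measurable Omega.
Hypothesis d0 : (0 < d)%N.
Variable c : R.
Hypothesis c0 : 0 < c.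
Hypothesis tail : forall x (r : R), Omega x -> 0 <= r ->
  fraction Omega [set y | r < `|x - y|] <= expR (- (c * r ^+ d)).

(** The scale is chosen so that c n h^d = 2 ln n: one factor exp(- ln n) pays
    for the O(n) points of the net, the other one keeps the dyadic series
    bounded. *)
Lemma expectation_upper_infinite (b : 'rV[R]_d) (L alpha : R) : 0 < alpha ->
  0 < L -> Omega !=set0 -> Omega `<=` cube b L ->
  exists2 C : R, 0 < C &
  forall (dT : measure_display) (T : measurableType dT)
      (P : probability T R) (X : nat -> {RV P >-> 'rV[R]_d}),
    (forall i, uniformly_distributed (X i) Omega) -> independent X ->
    forall n, (2 <= n)%N ->
    (\int[P]_w (poweR (Lnorm_on Omega +oo%E
                 (fun x => dist x (sample X n w))) alpha)
     <= (C * (n%:R `^ (- (alpha / d%:R)) * ln n%:R `^ (alpha / d%:R)))%:E)%E.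
Proof.
move=> alpha0 L0 O0 Ob.
have ln2 : 0 < ln 2 :> R by rewrite ln_gt0// ltr1n.
have [M M0 hM] := dyadic_series_finite ln2 alpha0.
have dR0 : 0 < d%:R :> R by rewrite ltr0n.
pose A : R := (2 / c) `^ d%:R^-1.
have A0 : 0 < A by rewrite powR_gt0// divr_gt0.
pose e := L / (A * ln 2 `^ d%:R^-1).
have e0 : 0 <= e by rewrite divr_ge0 ?(ltW L0)// mulr_ge0 ?powR_ge0// ltW.
have e1 : 0 < 1 + e by rewrite ltr_pwDl.
exists ((d%:R * (1 + e) * A) `^ alpha * (1 + 2 ^+ d * M)).
  rewrite mulr_gt0 ?powR_gt0 ?mulr_gt0//.
  by rewrite ltr_pwDl// mulr_ge0// exprn_ge0.
move=> dT T P X unifX indepX n n2.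
have n0 : (0 < n)%N by exact: leq_trans n2.
have nR0 : 0 < n%:R :> R by rewrite ltr0n.
have lnn : ln 2 <= ln n%:R :> R by rewrite ler_ln ?posrE// ler_nat.
have lnn0 : 0 < ln n%:R :> R by exact: lt_le_trans lnn.
pose u : R := n%:R `^ d%:R^-1.
have u1 : 1 <= u.
  have <- : 1 `^ d%:R^-1 = 1 :> R by rewrite powR1.
  by rewrite ge0_ler_powR ?nnegrE ?invr_ge0// ?ler1n.
have u0 : 0 < u by exact: lt_le_trans u1.
have ud : u ^+ d = n%:R by rewrite powR_root_expn.
(* A^d = 2 / c, hence c n h^d = 2 ln n. *)
pose h := A * ln n%:R `^ d%:R^-1 / u.
have h0 : 0 < h by rewrite divr_gt0// mulr_gt0// powR_gt0.
have hd : c * (n%:R * h ^+ d) = 2 * ln n%:R.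
  rewrite /h !exprMn exprVn ud !powR_root_expn//; last 2 first.
  - by rewrite ltW.
  - by rewrite divr_ge0// ltW.
  by field; rewrite !gt_eqF.
(* Between n and 2^d n cells, of side at most L n^(-1/d) <= e h. *)
pose m := (Num.truncn u).+1.
have um : u < m%:R by case/andP: (truncn_itv (ltW u0)).
have m2 : m%:R <= 2 * u.
  by have /andP[h1 _] := truncn_itv (ltW u0); rewrite /m -natr1; lra.
have [p [Op netp]] := finite_net L0 (ltn0Sn _ : (0 < m)%N) O0 Ob.
have Lm : L / m%:R <= e * h.
  apply: (@le_trans _ _ (L / u)).
    by rewrite ler_pM2l// lef_pV2 ?posrE ?ltr0n// ltW.
  rewrite /e /h -mulrA ler_pM2l//.
  rewrite mulrA.
  rewrite -[leLHS]mul1r ler_pM2r ?invr_gt0//.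
  rewrite ler_pdivlMl ?mulr1; last exact: mulr_gt0 A0 (powR_gt0 _ ln2).
  by rewrite ler_pM2l// ge0_ler_powR ?nnegrE ?invr_ge0// ltW.
pose S w : \bar R := (1 + \sum_j far_series X n h alpha w (p j))%E.
have fs0 w j : (0 <= far_series X n h alpha w (p j))%E by exact: far_series_ge0.
have mfs j : measurable_fun setT (fun w => far_series X n h alpha w (p j)).
  exact: measurable_far_series.
have S0 w : (0 <= S w)%E by rewrite adde_ge0// sume_ge0.
pose r := d%:R * (1 + e) * h.
have r0 : 0 < r by exact: (mulr_gt0 (mulr_gt0 dR0 e1) h0).
have ptw w : (poweR (Lnorm_on Omega +oo%E
     (fun x => dist x (sample X n w))) alpha <= (r `^ alpha)%:E * S w)%E.
  apply: Lnorm_on_infty_le => //; first exact: ltW.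
    by move=> x; exact: dist_sample_ge0.
  move=> x /netp[j xj].
  apply: le_trans (dist_sample_dyadic X w n0 d0 h0 alpha0 e0 (le_trans xj Lm)) _.
  rewrite lee_pmul2l// ?lte_fin ?powR_gt0// leeD2l//.
  by rewrite (bigD1 j)//= leeDl// sume_ge0.
apply: le_trans (ge0_le_integralW _ (fun=> poweR_ge0 _ _) ptw) _.
rewrite ge0_integralZl//; last 2 first.
- by apply: emeasurable_funD => //; exact: emeasurable_sum.
- by rewrite lee_fin powR_ge0.
rewrite ge0_integralD//; last 2 first.
- by move=> w _; exact: sume_ge0.
- exact: emeasurable_sum.
rewrite integral_cst// mul1e [X in (_ * (X + _))%E]probability_setT.
rewrite ge0_integral_sum//.
have term j : (\int[P]_w far_series X n h alpha w (p j) <= (n%:R^-1 * M)%:E)%E.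
  apply: le_trans (expectation_far_series mOmega unifX indepX tail n alpha d0
    (ltW c0) h0 (Op j)) _.
  rewrite hd EFinM; apply: le_trans (lee_wpmul2l _ hM); last first.
    by rewrite lee_fin invr_ge0.
  rewrite -nneseriesZl; last first.
    by move=> k _; rewrite lee_fin mulr_ge0 ?expR_ge0 ?dyadic_weight_ge0.
  apply: lee_nneseries => [k _ _|k _].
    by rewrite lee_fin mulr_ge0 ?expR_ge0 ?dyadic_weight_ge0.
  rewrite -EFinM lee_fin mulrCA ler_wpM2l ?dyadic_weight_ge0//.
  rewrite -{2}[n%:R]lnK ?posrE// -expRN -expRD ler_expR.
  have k1 : 1 <= 2 ^+ k :> R by rewrite exprn_ege1// ler1n.
  have : 0 <= (ln n%:R - ln 2) * 2 ^+ k :> R.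
    by rewrite mulr_ge0 ?exprn_ge0// subr_ge0.
  have : 0 <= ln n%:R * (2 ^+ k - 1) :> R by rewrite mulr_ge0 ?subr_ge0// ltW.
  lra.
apply: (@le_trans _ _ ((r `^ alpha)%:E * (1 + (2 ^+ d * M)%:E))%E).
  rewrite lee_pmul2l// ?lte_fin ?powR_gt0// leeD2l//.
  apply: le_trans (lee_sum _ (fun j _ => term j)) _.
  rewrite sumEFin lee_fin sumr_const card_ffun !card_ord.
  rewrite -[leLHS]mulr_natl mulrA ler_wpM2r// ler_pdivrMr//.
  rewrite -ud -exprMn natrX lerXn2r ?nnegrE// mulr_ge0//; exact: ltW.
rewrite -EFinD -EFinM lee_fin le_eqVlt; apply/orP; left; apply/eqP.
have -> : r = d%:R * (1 + e) * A * (ln n%:R `^ d%:R^-1 * n%:R `^ (- d%:R^-1)).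
  by rewrite /r /h powRN -/u !mulrA.
have B0 : 0 <= d%:R * (1 + e) * A.
  exact: mulr_ge0 (mulr_ge0 (ltW dR0) (ltW e1)) (ltW A0).
rewrite (powRM _ B0) ?mulr_ge0 ?powR_ge0//.
rewrite [X in _ * X * _ = _]powRM ?powR_ge0// -!powRrM mulNr.
by rewrite [_^-1 * alpha]mulrC; ring.
Qed.

End upper_infinite.

(** * Lower bounds *)

Section second_moment.
Context {dT} {T : measurableType dT} {R : realType} (P : probability T R).
Variables (I : finType) (A : I -> set T) (p : R).

(** Let Z be the number of events that occur.  Then 2 t Z - t^2 Z^2 <= 1 always,
    and the left side is 0 when Z = 0; taking expectations, with
    nu = E Z >= 1 and E Z^2 <= nu + nu^2, the choice t = 1 / (1 + nu) gives
    P (Z > 0) >= nu / (1 + nu) >= 1/2. *)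
Lemma second_moment_union : (forall j, measurable (A j)) -> 0 <= p ->
  (forall j, P (A j) = p%:E) ->
  (forall j k, j != k -> P (A j `&` A k) <= (p ^+ 2)%:E)%E ->
  1 <= #|I|%:R * p ->
  ((2^-1)%:E <= P (\bigcup_j A j))%E.
Proof.
move=> mA p0 PA PAA nu1; set U := \bigcup_j A j; set nu := #|I|%:R * p.
have mU : measurable U by apply: fin_bigcup_measurable => //; exact: finite_finset.
have nu_gt0 : 0 < 1 + nu by rewrite ltr_pwDr// (lt_le_trans ltr01).
pose t : R := (1 + nu)^-1; have t0 : 0 < t by rewrite invr_gt0.
pose Z w : R := \sum_j \1_(A j) w.
have ptw w : ((2 * t * Z w)%:E <= (\1_U w + t ^+ 2 * Z w ^+ 2)%:E)%E.
  rewrite lee_fin indicE; have [Uw|nUw] := boolP (w \in U).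
    by have := sqr_ge0 (1 - t * Z w); rewrite /=; nra.
  rewrite (_ : Z w = 0) ?mulr0 ?expr0n ?mulr0 ?addr0//.
  rewrite /Z big1// => j _; rewrite indicE memNset// => Ajw.
  by move/negP : nUw; apply; rewrite inE; exists j.
have m1 (B : set T) : measurable B -> measurable_fun setT (fun w => (\1_B w)%:E : \bar R).
  by move=> mB; apply/measurable_EFinP; exact: measurable_indic.
have intI (B : set T) : measurable B -> (\int[P]_w (\1_B w)%:E = P B)%E.
  by move=> mB; rewrite integral_indic// setIT.
have intZ : (\int[P]_w (2 * t * Z w)%:E = (2 * t * nu)%:E)%E.
  under eq_integral do rewrite EFinM /Z -sumEFin.
  rewrite ge0_integralZl//; last 3 first.
  - by apply: emeasurable_sum => j; exact: m1.
  - by move=> w _; apply: sume_ge0 => j _; rewrite lee_fin.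
  - by rewrite lee_fin mulr_ge0// ltW.
  rewrite ge0_integral_sum//; last by move=> j; exact: m1.
  rewrite (eq_bigr (fun=> p%:E)); last by move=> j _; rewrite intI// PA.
  by rewrite sumEFin sumr_const -EFinM -[p *+ _]mulr_natl.
have intZ2 : (\int[P]_w (\1_U w + t ^+ 2 * Z w ^+ 2)%:E <=
    P U + (t ^+ 2 * (nu + nu ^+ 2))%:E)%E.
  have Z2E w : Z w ^+ 2 = \sum_j \sum_k \1_(A j `&` A k) w.
    rewrite expr2 {1}/Z mulr_suml; apply: eq_bigr => j _.
    by rewrite /Z mulr_sumr; apply: eq_bigr => k _; rewrite indicI.
  under eq_integral do rewrite EFinD EFinM Z2E -sumEFin.
  have mAA j k : measurable (A j `&` A k) by exact: measurableI.
  have mS j : measurable_fun setT (fun w => (\sum_k \1_(A j `&` A k) w)%:E : \bar R).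
    under eq_fun do rewrite -sumEFin.
    by apply: emeasurable_sum => k; exact: m1.
  have S0 j w : (0 <= (\sum_k \1_(A j `&` A k) w)%:E :> \bar R)%E.
    by rewrite lee_fin sumr_ge0.
  have t20 : (0 <= (t ^+ 2)%:E :> \bar R)%E by rewrite lee_fin sqr_ge0.
  rewrite ge0_integralD//; last 3 first.
  - exact: m1.
  - by move=> w _; rewrite mule_ge0// sume_ge0.
  - by apply: measurable_funeM; exact: emeasurable_sum.
  rewrite intI// leeD2l// ge0_integralZl//; last 2 first.
  - exact: emeasurable_sum.
  - by move=> w _; exact: sume_ge0.
  rewrite [leRHS]EFinM lee_wpmul2l// ge0_integral_sum//.
  apply: (@le_trans _ _ (\sum_(j : I) (p + nu * p)%:E)%E); last first.
    by rewrite sumEFin sumr_const lee_fin -[leLHS]mulr_natl mulrDr mulrCA -/nu -expr2.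
  apply: lee_sum => j _; under eq_integral do rewrite -sumEFin.
  rewrite ge0_integral_sum//; last by move=> k; exact: m1.
  rewrite (eq_bigr (fun k => P (A j `&` A k))); last by move=> k _; rewrite intI.
  rewrite (bigD1 j)//= setIid PA EFinD leeD2l//.
  apply: (@le_trans _ _ (\sum_(k | k != j) (p ^+ 2)%:E)%E).
    by apply: lee_sum => k kj; rewrite PAA// eq_sym.
  rewrite sumEFin lee_fin sumr_const -[leLHS]mulr_natl /nu expr2 mulrA.
  by rewrite !ler_wpM2r// ler_nat max_card.
have Pfin : P U \is a fin_num by exact: fin_num_measure.
have mZ : measurable_fun setT Z.
  by apply: measurable_sum => j; exact: measurable_indic.
have Z0 w : 0 <= Z w by exact: sumr_ge0.
have : ((2 * t * nu)%:E <= P U + (t ^+ 2 * (nu + nu ^+ 2))%:E)%E.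
  rewrite -intZ; apply: le_trans intZ2; apply: ge0_le_integral => //.
  - by move=> w _; rewrite lee_fin mulr_ge0// mulr_ge0// ltW.
  - by apply/measurable_EFinP; apply: measurable_funM.
  - apply/measurable_EFinP; apply: measurable_funD; first exact: measurable_indic.
    by apply: measurable_funM => //; exact: measurable_funX.
rewrite -(fineK Pfin) -EFinD !lee_fin; set u := fine _.
have -> : t ^+ 2 * (nu + nu ^+ 2) = t * nu.
  by rewrite /t; field; rewrite gt_eqF.
have tnu : t * nu = 1 - t by rewrite /t; field; rewrite gt_eqF.
have : t <= 2^-1 by rewrite lef_pV2 ?posrE//; move: nu1; rewrite -/nu; lra.
by rewrite -mulrA tnu; lra.
Qed.

End second_moment.

Section lower_finite.
Context {R : realType} {d : nat}.
Notation mu := (lebesgue_rV R d).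
Variable Omega : set 'rV[R]_d.
Hypothesis mOmega : measurable Omega.
Hypothesis Ooo : (mu Omega < +oo)%E.
Hypothesis V0 : 0 < fine (mu Omega).
Hypothesis d0 : (0 < d)%N.

(** The bound holds for each outcome separately: cubes of side 2 r around the
    n sample points have total volume V / 2, so they leave half of Omega at
    distance at least r. *)
Lemma expectation_lower_finite (alpha gamma : R) : 0 < alpha -> 0 < gamma ->
  exists2 c : R, 0 < c &
  forall (dT : measure_display) (T : measurableType dT)
      (P : probability T R) (X : nat -> {RV P >-> 'rV[R]_d}),
    forall n, (0 < n)%N ->
    ((c * n%:R `^ (- (alpha / d%:R)))%:E <=
     \int[P]_w (poweR (Lnorm_on Omega gamma%:E
                 (fun x => dist x (sample X n w))) alpha))%E.
Proof.
move=> alpha0 gamma0; pose V := fine (mu Omega).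
have V0' : 0 < V := V0.
have VE : mu Omega = V%:E by rewrite fineK// ge0_fin_numE.
pose k : R := (V / 2) `^ d%:R^-1 / 2.
have k0 : 0 < k by rewrite divr_gt0// powR_gt0// divr_gt0.
exists ((k * (V / 2) `^ gamma^-1) `^ alpha).
  by rewrite powR_gt0// mulr_gt0// powR_gt0// divr_gt0.
move=> dT T P X n n0.
have nR0 : 0 < n%:R :> R by rewrite ltr0n.
pose r := k * n%:R `^ (- d%:R^-1).
have r0 : 0 < r by rewrite mulr_gt0// powR_gt0.
have rd : n%:R * (2 * r) ^+ d = V / 2.
  rewrite /r powRN /k.
  have -> : 2 * ((V / 2) `^ d%:R^-1 / 2 / n%:R `^ d%:R^-1) =
     (V / 2) `^ d%:R^-1 / n%:R `^ d%:R^-1.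
    by field; rewrite gt_eqF// powR_gt0.
  rewrite exprMn exprVn !powR_root_expn//; last by rewrite divr_ge0// ltW.
  by rewrite mulrC divfK// gt_eqF.
have ptw w : (((k * (V / 2) `^ gamma^-1) `^ alpha * n%:R `^ (- (alpha / d%:R)))%:E <=
    poweR (Lnorm_on Omega gamma%:E (fun x => dist x (sample X n w))) alpha)%E.
  pose Q i := cube (X i w - const_mx r) (2 * r).
  have mQ i : measurable (Q i) by exact: measurable_cube.
  pose W := \big[setU/set0]_(i < n) Q i.
  have mW : measurable W by apply: bigsetU_measurable => i _.
  pose B := Omega `\` W.
  have mB : measurable B by exact: measurableD.
  have BO : B `<=` Omega by move=> x [].
  have far_B x : B x -> r <= dist x (sample X n w).
    move=> [Ox nW]; apply: dist_sample_ge => // i ni.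
    rewrite leNgt; apply/negP => xr; apply: nW.
    rewrite /W -bigcup_mkord; exists i => // j.
    have := le_lt_trans (rV_coord_le_norm (x - X i w) j) xr.
    by rewrite !mxE ltr_norml; lra.
  have vB : ((V / 2)%:E <= mu B)%E.
    have WV : (mu W <= (V / 2)%:E)%E.
      apply: le_trans (Boole_inequality _ _) _ => //.
      rewrite (eq_bigr (fun=> ((2 * r) ^+ d)%:E)) => [|i _]; last first.
        by apply: mu_cube; rewrite mulr_ge0// ltW.
      by rewrite sumEFin sumr_const card_ord -[_ *+ _]mulr_natl rd.
    have : (mu Omega <= mu B + mu W)%E.
      apply: le_trans (measureU2 _ mB mW); apply: le_measure; rewrite ?inE//.
        exact: measurableU.
      by move=> x Ox; have [Wx|nW] := pselect (W x); [right|left].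
    rewrite VE => /le_trans/(_ (leeD2l _ WV)).
    by rewrite -leeBlDr// -EFinB; congr (_%:E <= _)%E; lra.
  have V20 : 0 <= V / 2 by rewrite divr_ge0// ltW.
  have := Lnorm_on_ge_finite mB BO (ltW r0)
     (fun x => dist_sample_ge0 X w x n0) far_B gamma0 V20 vB.
  have rV0 : 0 <= r * (V / 2) `^ gamma^-1 by rewrite mulr_ge0 ?powR_ge0// ltW.
  move=> Lge; apply: (@le_trans _ _ (poweR (r * (V / 2) `^ gamma^-1)%:E alpha)).
    rewrite poweR_EFin lee_fin le_eqVlt; apply/orP; left; apply/eqP.
    have kv0 : 0 <= k * (V / 2) `^ gamma^-1.
      exact: mulr_ge0 (ltW k0) (powR_ge0 _ _).
    have -> : r * (V / 2) `^ gamma^-1 =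
        (k * (V / 2) `^ gamma^-1) * n%:R `^ (- d%:R^-1) by rewrite /r; ring.
    by rewrite [RHS]powRM ?powR_ge0// -powRrM mulNr [_^-1 * _]mulrC.
  apply: gt0_ler_poweR; rewrite ?in_itv/= ?leey ?andbT ?Lnorm_ge0// ltW//.
apply: le_trans (ge0_le_integralW _ _ ptw).
  by rewrite integral_cst// [X in (_ * X)%E]probability_setT mule1.
by move=> w; rewrite lee_fin mulr_ge0 ?powR_ge0.
Qed.

End lower_finite.

Section lower_infinite.
Context {R : realType} {d : nat}.
Notation mu := (lebesgue_rV R d).
Variable Omega : set 'rV[R]_d.
Hypothesis mOmega : measurable Omega.
Hypothesis Ooo : (mu Omega < +oo)%E.
Hypothesis V0 : 0 < fine (mu Omega).
Hypothesis d0 : (0 < d)%N.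

(** Since 1 - x >= exp(- 2 x) on [0, 1/2], it suffices that
    ln N >= 2 q n / N.  For N >= 4 n / ln n the right side is at most
    (ln n) / 2, and the left side is at least that because
    ln (ln n / 2) <= (ln n) / 2. *)
Lemma expected_empty_cells (n : nat) (N q : R) : (2 <= n)%N -> 0 < q <= 1 ->
  4 * n%:R / ln n%:R <= N -> 1 <= N * (1 - q / N) ^+ n.
Proof.
move=> n2 /andP[q0 q1]; set t := ln n%:R => yN.
have nR0 : 0 < n%:R :> R by rewrite ltr0n (leq_trans _ n2).
have t0 : 0 < t by rewrite ln_gt0// ltr1n.
have tn : t < n%:R by exact: ln_sublinear.
have y4 : 4 <= 4 * n%:R / t by rewrite ler_pdivlMr//; lra.
have y0 : 0 < 4 * n%:R / t by lra.
have N0 : 0 < N by lra.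
have qN : q / N <= 2^-1 by rewrite ler_pdivrMr//; lra.
have qN0 : 0 <= q / N by rewrite divr_ge0 ?ltW.
have lnN : t / 2 <= ln N.
  apply: (@le_trans _ _ (ln (4 * n%:R / t))); last by rewrite ler_ln ?posrE.
  rewrite ln_div ?posrE ?mulr_gt0// lnM ?posrE// -/t.
  have : ln (t / 2) < t / 2 by rewrite ln_sublinear// divr_gt0.
  rewrite ln_div ?posrE//.
  have : ln 2 <= ln 4 :> R by rewrite ler_ln ?posrE// ler_nat.
  by lra.
apply: (@le_trans _ _ (N * expR (- (2 * (q / N))) ^+ n)); last first.
  rewrite ler_pM2l// lerXn2r ?nnegrE ?expR_ge0//; first by lra.
  by apply: expR_le_1B; rewrite qN0.
rewrite -expRM_natl -{1}[N]lnK ?posrE// -expRD -[leLHS]expR0 ler_expR.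
suff : n%:R * (2 * (q / N)) <= t / 2 by lra.
have -> : n%:R * (2 * (q / N)) = (2 * n%:R * q) / N by ring.
rewrite ler_pdivrMr//.
have : 4 * n%:R <= t * N by rewrite [leRHS]mulrC -ler_pdivrMr.
have : n%:R * q <= n%:R by rewrite ler_piMr// ltW.
lra.
Qed.

(** The number m of cells per side is the least integer above
    (4 n / ln n)^(1/d), so that [expected_empty_cells] applies to N = m^d while
    the side s / m still has the order (ln n / n)^(1/d). *)
Lemma expectation_lower_infinite (a : 'rV[R]_d) (s alpha : R) : 0 < alpha ->
  0 < s -> cube a s `<=` Omega ->
  exists2 c : R, 0 < c &
  forall (dT : measure_display) (T : measurableType dT)
      (P : probability T R) (X : nat -> {RV P >-> 'rV[R]_d}),
    (forall i, uniformly_distributed (X i) Omega) -> independent X ->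
    forall n, (2 <= n)%N ->
    ((c * (n%:R `^ (- (alpha / d%:R)) * ln n%:R `^ (alpha / d%:R)))%:E <=
    \int[P]_w (poweR (Lnorm_on Omega +oo%E
                 (fun x => dist x (sample X n w))) alpha))%E.
Proof.
move=> alpha0 s0 aO; pose V := fine (mu Omega); have V0' : 0 < V := V0.
have VE : mu Omega = V%:E by rewrite fineK// ge0_fin_numE.
pose k : R := s / 8 * 4 `^ (- d%:R^-1).
have k0 : 0 < k by rewrite mulr_gt0 ?powR_gt0// divr_gt0.
exists (k `^ alpha / 2); first by rewrite divr_gt0// powR_gt0.
move=> dT T P X unifX indepX n n2.
have n0 : (0 < n)%N by exact: leq_trans n2.
have nR0 : 0 < n%:R :> R by rewrite ltr0n.
have ln0 : 0 < ln n%:R :> R by rewrite ln_gt0// ltr1n.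
pose y : R := 4 * n%:R / ln n%:R.
have y4 : 4 <= y.
  by rewrite ler_pdivlMr// ler_pM2l// ltW// ln_sublinear.
have y0 : 0 < y by lra.
pose S := y `^ d%:R^-1.
have S0 : 0 < S by rewrite powR_gt0.
have S1 : 1 <= S.
  have <- : 1 `^ d%:R^-1 = 1 :> R by rewrite powR1.
  by rewrite ge0_ler_powR ?nnegrE ?invr_ge0// ?(ltW y0)//; lra.
have Sd : S ^+ d = y by rewrite powR_root_expn// ltW.
pose m := (Num.truncn S).+1.
have Sm : S < m%:R by case/andP: (truncn_itv (ltW S0)).
have mR0 : 0 < m%:R :> R by rewrite ltr0n.
have m2 : m%:R <= 2 * S.
  by have /andP[h1 _] := truncn_itv (ltW S0); rewrite /m -natr1; lra.
pose N : R := m%:R ^+ d.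
have yN : y <= N by rewrite -Sd lerXn2r ?nnegrE ?(ltW S0) ?(ltW mR0) ?(ltW Sm).
have N0 : 0 < N by lra.
pose q := s ^+ d / V.
have q0 : 0 < q by rewrite divr_gt0// exprn_gt0.
have q1 : q <= 1.
  rewrite ler_pdivrMr// mul1r -lee_fin -VE -(mu_cube a (ltW s0)).
  by apply: le_measure; rewrite ?inE//; exact: measurable_cube.
have qN2 : 2 * (q / N) <= 1.
  have : q / N <= 2^-1 by rewrite ler_pdivrMr//; lra.
  lra.
pose l := s / m%:R; have l0 : 0 < l by rewrite divr_gt0.
have lV : l ^+ d / V = q / N by rewrite expr_div_n -/N /q mulrAC.
pose C (j : {ffun 'I_d -> 'I_m}) := cell a s j.
have mC j : measurable (C j) by exact: measurable_cube.
have CO j : C j `<=` Omega.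
  by apply: subset_trans aO; exact: cell_sub.
have muC j : mu (C j) = (l ^+ d)%:E by apply: mu_cube; exact: ltW.
pose A j := [set w | forall i, (i < n)%N -> (~` C j) (X i w)].
have mA j : measurable (A j).
  rewrite (_ : A j = \bigcap_(i in `I_n) (X i @^-1` (~` C j)))//.
  apply: bigcap_measurableType => i _; rewrite -[X in measurable X]setTI.
  by apply: measurable_funPT => //; exact: measurableC.
have PA j : P (A j) = ((1 - q / N) ^+ n)%:E.
  rewrite (prob_forall mOmega unifX indepX); last exact: measurableC.
  by rewrite (fractionC mOmega (mC j) (@CO j) (muC j) Ooo V0) -/V lV.
have PAA j j' : j != j' ->
    (P (A j `&` A j') <= (((1 - q / N) ^+ n) ^+ 2)%:E)%E.
  move=> jj'; have mU : measurable (C j `|` C j') by exact: measurableU.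
  have UO : C j `|` C j' `<=` Omega by move=> x [/CO|/CO].
  have muU : mu (C j `|` C j') = (l ^+ d + l ^+ d)%:E.
    rewrite measureU//; last exact: cell_disj.
    by rewrite [X in (X + _)%E]muC [X in (_ + X)%E]muC.
  rewrite (_ : _ `&` _ = [set w | forall i, (i < n)%N ->
      (~` (C j `|` C j')) (X i w)]); last first.
    apply/seteqP; split=> w /=.
      by move=> [h1 h2] i ni [/h1|/h2]; exact.
    by move=> h; split=> i ni Cx; apply: (h i ni); [left|right].
  rewrite (prob_forall mOmega unifX indepX); last exact: measurableC.
  (* Negative correlation: 1 - 2 x <= (1 - x)^2. *)
  rewrite (fractionC mOmega mU UO muU Ooo V0) -/V mulrDl lV lee_fin -exprM mulnC exprM.
  rewrite lerXn2r ?nnegrE ?sqr_ge0//; first by lra.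
  by have := sqr_ge0 (q / N); rewrite sqrrB; lra.
have NE : #|{ffun 'I_d -> 'I_m}|%:R = N.
  by rewrite card_ffun !card_ord natrX.
have q01 : 0 < q <= 1 by rewrite q0.
have p0 : 0 <= (1 - q / N) ^+ n by rewrite exprn_ge0//; lra.
have nu1 : 1 <= #|{ffun 'I_d -> 'I_m}|%:R * (1 - q / N) ^+ n.
  by rewrite NE expected_empty_cells.
have PU := second_moment_union mA p0 PA PAA nu1.
set U := \bigcup_j A j in PU.
have mU : measurable U.
  by apply: fin_bigcup_measurable => //; exact: finite_finset.
(* The concentric cube of half the side stays at distance l / 4 from the
   complement of the cell. *)
pose r := l / 4; have r0 : 0 < r by rewrite divr_gt0.
have LU w : U w -> (r%:E <= Lnorm_on Omega +oo%E
    (fun x => dist x (sample X n w)))%E.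
  move=> [j _ Ajw]; pose B := cube (corner a s j + const_mx r) (2 * r).
  have BC x z : B x -> `|x - z| < r -> C j z.
    move=> Bx xz i; have := Bx i.
    have := le_lt_trans (rV_coord_le_norm (x - z) i) xz.
    by rewrite -/l !mxE ltr_norml /r; lra.
  apply: (@Lnorm_on_ge_infinite _ _ Omega B) => //.
  - exact: measurable_cube.
  - by move=> x Bx; apply: (@CO j); apply: (BC _ _ Bx); rewrite subrr normr0.
  - by move=> x; exact: dist_sample_ge0.
  - move=> x Bx; apply: dist_sample_ge => // i ni.
    by rewrite leNgt; apply/negP => /(BC _ _ Bx); exact: Ajw.
  - have r2 : 0 < 2 * r by rewrite mulr_gt0.
    by rewrite mu_cube ?lte_fin ?exprn_gt0 ?(ltW r2).
have ptw w : ((r `^ alpha)%:E * (\1_U w)%:E <= poweR (Lnorm_on Omega +oo%E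
    (fun x => dist x (sample X n w))) alpha)%E.
  rewrite indicE; have [Uw|_] := boolP (w \in U); last first.
    by rewrite mule0 poweR_ge0.
  rewrite inE in Uw; rewrite mule1 -poweR_EFin.
  apply: gt0_ler_poweR; rewrite ?in_itv/= ?leey ?andbT ?Lnorm_ge0//.
  - exact: ltW.
  - by rewrite lee_fin ltW.
  - exact: LU.
apply: le_trans (ge0_le_integralW _ _ ptw); last first.
  by move=> w; rewrite mule_ge0 ?lee_fin ?powR_ge0.
rewrite ge0_integralZl//; last 2 first.
- by apply/measurable_EFinP; exact: measurable_indic.
- by rewrite lee_fin powR_ge0.
rewrite integral_indic// setIT.
apply: (@le_trans _ _ ((r `^ alpha)%:E * (2^-1)%:E)%E); last first.
  by rewrite lee_wpmul2l// lee_fin powR_ge0.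
rewrite -EFinM lee_fin mulrAC ler_pM2r//.
apply: (@le_trans _ _ ((s / (8 * S)) `^ alpha)); last first.
  rewrite ge0_ler_powR ?nnegrE ?(ltW alpha0) ?(ltW r0)//.
    by rewrite divr_ge0 ?mulr_ge0 ?(ltW s0)// ltW.
  rewrite /r /l -mulrA ler_pM2l// -invfM lef_pV2 ?posrE ?mulr_gt0//.
  by lra.
rewrite le_eqVlt; apply/orP; left; apply/eqP.
have -> : s / (8 * S) = k * (n%:R `^ (- d%:R^-1) * ln n%:R `^ d%:R^-1).
  rewrite /S /y powRM ?mulr_ge0 ?invr_ge0 ?(ltW nR0) ?(ltW ln0)//.
  rewrite powRM ?(ltW nR0)// -[(ln _)^-1]powR_inv1 ?(ltW ln0)// -powRrM mulN1r.
  by rewrite /k !powRN; field; rewrite !gt_eqF ?powR_gt0.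
rewrite [RHS]powRM ?(ltW k0) ?mulr_ge0 ?powR_ge0//.
rewrite [X in _ = _ * X]powRM ?powR_ge0//.
by rewrite -!powRrM mulNr [_^-1 * _]mulrC.
Qed.

End lower_infinite.

(** * Order of the expected norm *)

Theorem proposition1 (R : realType) (d : nat) (Omega : set 'rV[R]_d)
    (alpha : R) (gamma : \bar R) :
  (0 < d)%N ->
  Omega !=set0 -> open Omega -> bounded_set Omega ->
  convex_set (Omega : set (convex_lmodType 'rV[R]_d)) ->
  0 < alpha -> (0 < gamma)%E ->
  exists c C : R, [/\ 0 < c, c <= C &
    forall (dT : measure_display) (T : measurableType dT)
      (P : probability T R) (X : nat -> {RV P >-> 'rV[R]_d}),
      (forall i, uniformly_distributed (X i) Omega) ->
      independent X ->
      forall n : nat, (2 <= n)%N ->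
        ((c * rate d alpha gamma n)%:E
           <= \int[P]_w (poweR (Lnorm_on Omega gamma
                                  (fun x => dist x (sample X n w))) alpha)
           <= (C * rate d alpha gamma n)%:E)%E].
Proof.
move=> d0 O0 oO bO cO alpha0 gamma0.
have mO := open_measurable_rV oO.
have [b [L [L0 Ob OL]]] := bounded_sub_cube bO.
have [a [s [s0 aO]]] := open_sup_cube O0 oO.
have Ooo := mu_lt_pinfty mO (ltW L0) Ob.
have V0 : 0 < fine (lebesgue_rV R d Omega).
  rewrite fine_gt0// Ooo andbT.
  apply: lt_le_trans (_ : ((s ^+ d)%:E <= _)%E).
    by rewrite lte_fin exprn_gt0.
  rewrite -(mu_cube a (ltW s0)); apply: le_measure; rewrite ?inE//.
  exact: measurable_cube.
have [k k0 tail] := fraction_tail mO cO d0 Ooo s0 aO L0 OL.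
have rate0 n : 0 <= rate d alpha gamma n.
  by rewrite /rate; case: ifP => _; rewrite ?mulr_ge0 ?powR_ge0.
suff [c [C [c0 C0 hcC]]] : exists c C : R, [/\ 0 < c, 0 < C &
    forall (dT : measure_display) (T : measurableType dT)
      (P : probability T R) (X : nat -> {RV P >-> 'rV[R]_d}),
      (forall i, uniformly_distributed (X i) Omega) ->
      independent X ->
      forall n : nat, (2 <= n)%N ->
        ((c * rate d alpha gamma n)%:E
           <= \int[P]_w (poweR (Lnorm_on Omega gamma
                                  (fun x => dist x (sample X n w))) alpha)
           <= (C * rate d alpha gamma n)%:E)%E].
  exists (Num.min c C), C; split; first by rewrite lt_min c0 C0.
    by rewrite ge_min lexx orbT.
  move=> dT T P X unifX indepX n n2.
  have /andP[h1 ->] := hcC dT T P X unifX indepX n n2; rewrite andbT.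
  by apply: le_trans h1; rewrite lee_fin ler_wpM2r// ge_min lexx.
case: gamma gamma0 rate0 => [gamma|_ _|//]; last first.
  have [C C0 hC] := expectation_upper_infinite mO d0 k0 tail alpha0 L0 O0 Ob.
  have [c c0 hc] := expectation_lower_infinite mO Ooo V0 d0 alpha0 s0 aO.
  exists c, C; split=> // dT T P X unifX indepX n n2.
  by rewrite /rate eqxx hc// hC.
rewrite lte_fin => gamma0 _.
have [C C0 hC] := expectation_upper_finite mO Ooo d0 k0 tail alpha0 gamma0.
have [c c0 hc] := expectation_lower_finite mO Ooo V0 d0 alpha0 gamma0.
exists c, C; split=> // dT T P X unifX indepX n n2.
by rewrite /rate /= hc ?hC// (leq_trans _ n2).
Qed.
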